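(* Let $p$ be a prime and let $m\geq 3$ be an integer. There is an uncountable family of pairwise non-commensurable finitely presented pro-$p$ groups $G$ with $d(G)=m$, none of which is the pro-$p$ completion of any finitely presented abstract group. In particular, no group in this family has a finite pro-$p$ presentation in which all the relations are of finite length (as words on the generators).
   Context: For a pro-$p$ group $G$, $d(G)$ denotes the minimal number of topological generators. Two pro-$p$ groups are commensurable if they have open subgroups that are isomorphic to each other (as topological groups). A pro-$p$ group $G$ is finitely presented (as a pro-$p$ group) if $G\cong F/R$ with $F$ a free pro-$p$ group on a finite set $X$ and $R$ the closed normal closure of finitely many elements of $F$, called the relations. A relation is of finite length if it is a word in the generators $X$ and their inverses, i.e. lies in the abstract free group on $X$ inside $F$. *)

(* Defs.v *)
From HB Require Import structures.
From mathcomp Require Import all_boot.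
From mathcomp Require Import boolp classical_sets functions cardinality topology.

Set Implicit Arguments.
Unset Strict Implicit.
Unset Printing Implicit Defensive.

Local Open Scope classical_set_scope.
Local Open Scope group_scope.
Local Open Scope card_scope.

HB.mixin Record isTopGroup G of Group G & Topological G := {
  mulg_continuous : continuous (fun xy : G * G => xy.1 * xy.2);
  invg_continuous : continuous (fun x : G => x^-1)
}.

#[short(type="topGroupType")]
HB.structure Definition TopGroup :=
  {G of isTopGroup G & Group G & Topological G}.

Section AbstractGroups.

Definition is_subgroup (G : groupType) (H : set G) : Prop :=
  group_closed [in H].

Definition is_normal_subgroup (G : groupType) (N : set G) : Prop :=
  is_subgroup N /\ forall x g : G, N x -> N (x ^ g).

Definition left_cosets (G : groupType) (H : set G) : set (set G) :=
  [set [set x * h | h in H] | x in [set: G]].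

Definition is_hom (G H : groupType) (f : G -> H) : Prop :=
  {morph f : x y / x * y}.

Definition hom_kernel (G H : groupType) (f : G -> H) : set G :=
  f @^-1` [set 1].

Definition generated_subgroup (G : groupType) (A : set G) : set G :=
  smallest (@is_subgroup G) A.

Definition normal_closure (G : groupType) (A : set G) : set G :=
  smallest (@is_normal_subgroup G) A.

(* The letter (a, false) stands for a, the letter (a, true) for its inverse. *)
Definition word_value (X : Type) (G : groupType) (x : X -> G)
    (w : seq (X * bool)) : G :=
  \prod_(a <- w) (if a.2 then (x a.1)^-1 else x a.1).

Definition is_free_group (X : Type) (F : groupType) (i : X -> F) : Prop :=
  forall (G : groupType) (f : X -> G),
    exists! phi : F -> G, is_hom phi /\ phi \o i = f.

(* A surjective homomorphism F -> G with kernel R is the same thing as an     *)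
(* isomorphism between F / R and G.                                           *)
Definition finitely_presented_group (G : groupType) : Prop :=
  exists (X : finType) (F : groupType) (i : X -> F) (A : set F) (phi : F -> G),
    [/\ is_free_group i, finite_set A, is_hom phi, range phi = [set: G]
      & hom_kernel phi = normal_closure A].

End AbstractGroups.

Section ProPGroups.

Definition is_pro_p (p : nat) (G : topGroupType) : Prop :=
  [/\ compact [set: G],
      hausdorff_space G,
      (forall U : set G, nbhs (1 : G) U ->
         exists H : set G, [/\ open H, is_subgroup H & H `<=` U])
    & (forall N : set G, open N -> is_normal_subgroup N ->
         exists k : nat, left_cosets N #= `I_(p ^ k))].

Definition topologically_generated_by (G : topGroupType) (n : nat) : Prop :=
  exists2 A : set G, A #= `I_n & closure (generated_subgroup A) = [set: G].

(* d(G) = n *)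
Definition min_generators (G : topGroupType) (n : nat) : Prop :=
  topologically_generated_by G n
  /\ forall k : nat, topologically_generated_by G k -> n <= k.

(* H and K carry the topologies induced by G and G'; the values of f and g    *)
(* outside H and K are irrelevant.                                            *)
Definition top_isomorphic_subgroups (G G' : topGroupType)
    (H : set G) (K : set G') : Prop :=
  exists (f : G -> G') (g : G' -> G),
    [/\ {in H &, {morph f : x y / x * y}},
        f @` H `<=` K /\ g @` K `<=` H,
        {in H, cancel f g} /\ {in K, cancel g f},
        {within H, continuous f}
      & {within K, continuous g}].

Definition commensurable (G G' : topGroupType) : Prop :=
  exists (H : set G) (K : set G'),
    [/\ open H, is_subgroup H, open K, is_subgroup K
      & top_isomorphic_subgroups H K].

Definition closed_normal_closure (G : topGroupType) (A : set G) : set G :=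
  smallest [set N | is_normal_subgroup N /\ closed N] A.

(* Only used for finite X, where no condition that the images of the          *)
(* generators converge to 1 is needed.                                        *)
Definition is_free_pro_p (p : nat) (X : finType) (F : topGroupType)
    (i : X -> F) : Prop :=
  is_pro_p p F
  /\ forall (P : topGroupType) (f : X -> P), is_pro_p p P ->
       exists! phi : F -> P, [/\ is_hom phi, continuous phi & phi \o i = f].

(* A continuous open surjective homomorphism F -> G with kernel R is the same *)
(* thing as an isomorphism of topological groups between F / R and G.         *)
Definition is_finite_pro_p_presentation (p : nat) (G : topGroupType)
    (X : finType) (F : topGroupType) (i : X -> F) (A : set F) : Prop :=
  [/\ is_free_pro_p p i, finite_set A
    & exists phi : F -> G,
        [/\ is_hom phi, continuous phi, (forall U, open U -> open (phi @` U)),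
            range phi = [set: G] & hom_kernel phi = closed_normal_closure A]].

Definition finitely_presented_pro_p (p : nat) (G : topGroupType) : Prop :=
  exists (X : finType) (F : topGroupType) (i : X -> F) (A : set F),
    is_finite_pro_p_presentation p G i A.

Definition finite_length (X : finType) (F : topGroupType) (i : X -> F)
    (r : F) : Prop :=
  exists w : seq (X * bool), r = word_value i w.

Definition has_finite_length_presentation (p : nat) (G : topGroupType) : Prop :=
  exists (X : finType) (F : topGroupType) (i : X -> F) (A : set F),
    is_finite_pro_p_presentation p G i A
    /\ forall r : F, A r -> finite_length i r.

(* The pro-p completion of Gamma is specified by its universal property among *)
(* the homomorphisms from Gamma to pro-p groups.                              *)
Definition is_pro_p_completion (p : nat) (Gamma : groupType)
    (G : topGroupType) : Prop :=
  is_pro_p p G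
  /\ exists j : Gamma -> G, is_hom j
     /\ forall (P : topGroupType) (f : Gamma -> P), is_pro_p p P -> is_hom f ->
          exists! phi : G -> P, [/\ is_hom phi, continuous phi & phi \o j = f].

End ProPGroups.

(* Main.v *)
Require Import Defs.
From HB Require Import structures.
From mathcomp Require Import all_boot all_fingroup all_solvable all_algebra zify.
From mathcomp Require Import boolp classical_sets functions cardinality topology.

(** Countably many groups are excluded by the last two properties.  A pro-p
    group that is the completion of a finitely presented group, or that has a
    presentation with relations of finite length, is the largest pro-p group
    generated by k elements subject to a finite list of words
    ([completion_coded], [finite_length_coded]).  The list determines the group
    up to isomorphism ([coded_by_commensurable]), and there are countably many
    lists.  So it is enough to find uncountably many pairwise non-commensurable
    finitely presented pro-p groups with d(G) = m, and to discard countably many.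

    Such groups exist among the semidirect products of Z_p^n by Z_p, n = m - 1,
    in which the generator t of Z_p scales the i-th line by a unit v_i in
    1 + p Z_p.  With generators t, a_1, ..., a_n, the relations [a_i, a_j] = 1
    and t^-1 a_i t = a_i^(v_i) present such a group; the p-adic power a_i^(v_i)
    is where relations of infinite length enter.  Modulo p the action is
    trivial, so the Frattini quotient has rank n + 1.

    The family varies the first unit, u = 1 + p^3 (1 + sum_j eps_j p^(j+1)), with
    a free binary sequence eps, and keeps the others equal to 1 + p^2.  An
    isomorphism f between open subgroups of two members sends a power t^s,
    s = p^N, to an element that acts as some p-adic power t'^x of t'.  It sends
    the commutators with t^s, which are translations, to translations, so each
    of u^s and (1 + p^2)^s is an eigenvalue of t'^x, namely u'^x or (1 + p^2)^x
    ([commensurable_eigenvalues]).  As u - 1 has valuation 3 and the other unit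
    minus 1 has valuation 2, lifting the exponent shows that no crossed matching
    is possible; then (1 + p^2)^x = (1 + p^2)^s gives x = s, and u^s = u'^s gives
    u = u' ([exponent_rigidity]).

    No ring of p-adic integers is constructed.  Both the free pro-p groups and
    the semidirect products are obtained as the closure, in a product of finite
    p-groups, of the subgroup generated by finitely many elements
    ([limit_group]), and p-adic integers appear as compatible sequences of
    residues.  For the free group the factors are all finite p-groups with a
    choice of generators; its universal property follows by compactness of the
    target ([free_pro_p_exists]).  That the relations suffice is checked on
    finite quotients: a finite p-group that satisfies them is a quotient of one
    of the finite semidirect products ([level_homM]). *)

Set Implicit Arguments.
Unset Strict Implicit.
Unset Printing Implicit Defensive.

(** * Valuations of differences of powers *)

Lemma expn_taylor y z N :
  exists r, (y + z) ^ N = y ^ N + z * (N * y ^ N.-1 + r * z).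
Proof.
elim: N => [|N [r IHN]]; first by exists 0; rewrite !expn0 !muln0.
exists (N * y ^ N.-1 + r * (y + z)); rewrite expnS IHN.
case: N {IHN} => [|N]; first by rewrite !expn0 !expn1; nia.
by rewrite /= !expnS; set Y := y ^ N; nia.
Qed.

Lemma dvdn_pow_sub1 p y z j : 0 < j -> p ^ j %| z -> y = 1 + z ->
  p ^ j.+1 %| y ^ p - 1.
Proof.
move=> j0 jz ->; have [r ->] := expn_taylor 1 z p.
rewrite exp1n addKn expnSr dvdn_mul // exp1n muln1 dvdn_addr //.
rewrite dvdn_mull // (dvdn_trans _ jz) //.
by case: j j0 {jz} => // j _; rewrite expnS dvdn_mulr.
Qed.

(** In z (N y^(N-1) + r z) the second factor has the valuation of N as soon as z
    has a larger one. *)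
Lemma logn_sub_expn_step p y z N : prime p -> ~~ (p %| y) -> 0 < z -> 0 < N ->
    logn p N < logn p z ->
  logn p ((y + z) ^ N - y ^ N) = logn p z + logn p N.
Proof.
move=> pp py z0 N0 Nz; have [r ->] := expn_taylor y z N.
rewrite addKn; have y0 : 0 < y by case: y py; rewrite ?dvdn0.
have [N' pN' eN] := pfactor_coprime pp N0.
have [z' pz' ez] := pfactor_coprime pp z0.
set a := logn p N in Nz eN *; set b := logn p z in Nz ez *.
have zE : z = p ^ a * (p * (p ^ (b - a).-1 * z')).
  have Eb : p ^ b = p ^ a * (p * p ^ (b - a).-1).
    by rewrite -expnS prednK ?subn_gt0 // -expnD subnKC // ltnW.
  by rewrite [LHS]ez Eb; nia.
have -> : N * y ^ N.-1 + r * z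
    = p ^ a * (N' * y ^ N.-1 + p * (r * (p ^ (b - a).-1 * z'))).
  rewrite mulnDr; congr (_ + _); first by rewrite {1}eN; nia.
  by rewrite {1}zE; nia.
have cop : coprime p (N' * y ^ N.-1 + p * (r * (p ^ (b - a).-1 * z'))).
  rewrite prime_coprime // (dvdn_addl _ (dvdn_mulr _ (dvdnn p))) Euclid_dvdM //.
  rewrite negb_or.
  rewrite -prime_coprime // pN' /=; by rewrite Euclid_dvdX // (negPf py).
have r0 : 0 < N' * y ^ N.-1 + p * (r * (p ^ (b - a).-1 * z')).
  by rewrite lt0n; apply/eqP=> E; move: cop; rewrite E /coprime gcdn0 => /eqP p1;
    move: pp; rewrite p1.
have pa : 0 < p ^ a by rewrite expn_gt0 prime_gt0.
by rewrite lognM ?muln_gt0 ?pa // (lognM _ pa r0) pfactorK // (logn_coprime cop) addn0.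
Qed.

(** The restriction of the preceding lemma on N is removed by raising to the
    power p repeatedly, one factor p at a time; each step is allowed because the
    difference of the bases is divisible by p ^ 2. *)
Lemma logn_sub_expn p y z N : prime p -> ~~ (p %| y) -> 0 < z -> 0 < N ->
    1 < logn p z ->
  logn p ((y + z) ^ N - y ^ N) = logn p z + logn p N.
Proof.
move=> pp py z0; move: {2}(logn p N) (erefl (logn p N)) => e.
elim: e N => [|e IHe] N eN N0 z1.
  by apply: logn_sub_expn_step; rewrite // eN ltnW.
have pN : p %| N by rewrite -[p]expn1 pfactor_dvdn // eN.
have [M NM] := dvdnP pN; have M0 : 0 < M by move: N0; rewrite NM muln_gt0 => /andP[].
have lp : logn p p = 1 by rewrite -{2}[p]expn1 pfactorK.
have lM : logn p (M * p) = (logn p M).+1.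
  by rewrite (lognM _ M0 (prime_gt0 pp)) lp addn1.
have eM : logn p M = e by move: eN; rewrite NM lM => -[].
have IH := IHe M eM M0 z1; rewrite NM !expnM.
have yz : y ^ M <= (y + z) ^ M by rewrite leq_exp2r // leq_addr.
rewrite -{1}(subnKC yz) logn_sub_expn_step ?IH //.
- by rewrite lM lp; lia.
- by rewrite Euclid_dvdX // (negPf py).
- by rewrite subn_gt0 ltn_exp2r //; lia.
- exact: prime_gt0.
- by rewrite lp; lia.
Qed.

(** Stated with divisibility, because logn p 0 = 0 whereas the valuation at
    x = 0 should be infinite. *)
Lemma dvdn_expn_sub1 p z x c : prime p -> 1 < logn p z ->
  (p ^ c %| (1 + z) ^ x - 1) = (p ^ (c - logn p z) %| x).
Proof.
move=> pp z1; have z0 : 0 < z by case: z z1; rewrite ?logn0.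
have [->|x0] := posnP x; first by rewrite expn0 subnn !dvdn0.
have E := logn_sub_expn pp (_ : ~~ (p %| 1)) z0 x0 z1.
rewrite dvdn1 exp1n in E; rewrite pfactor_dvdn //; last first.
  by rewrite subn_gt0 -{1}(exp1n x) ltn_exp2r //; lia.
by rewrite E ?gtn_eqF ?prime_gt1 // pfactor_dvdn //; lia.
Qed.

(** To finite precision the exponent x can be read off from (1 + z) ^ x. *)
Lemma expn_eqmod p z x y c : prime p -> 1 < logn p z ->
  ((1 + z) ^ x == (1 + z) ^ y %[mod p ^ c]) = (x == y %[mod p ^ (c - logn p z)]).
Proof.
move=> pp z1; wlog xy : x y / x <= y => [W|].
  by have [xy|/ltnW yx] := leqP x y; [|rewrite eq_sym [RHS]eq_sym]; apply: W.
rewrite eq_sym [RHS]eq_sym !eqn_mod_dvd ?leq_pexp2l //.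
rewrite -{1}(subnKC xy) expnD -[X in _ - X]muln1 -mulnBr Gauss_dvdr.
  exact: dvdn_expn_sub1.
apply: coprimeXr; apply: coprimeXl; rewrite prime_coprime // dvdn_addl ?dvdn1.
  by rewrite gtn_eqF ?prime_gt1.
by rewrite -[p]expn1 pfactor_dvdn ?(ltnW z1) //; case: z z1; rewrite ?logn0.
Qed.

Lemma eqmod_expn_base p z z' s c : prime p -> 0 < s ->
    1 < logn p z -> 1 < logn p z' ->
    (1 + z) ^ s = (1 + z') ^ s %[mod p ^ c] ->
  1 + z = 1 + z' %[mod p ^ (c - logn p s)].
Proof.
move=> pp s0; wlog zz : z z' / z <= z' => [W|] z1 z'1 E.
  have [zz|/ltnW zz] := leqP z z'; first exact: W zz z1 z'1 E.
  by apply/esym/(W _ _ zz z'1 z1)/esym.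
have dv y : 1 < logn p y -> p ^ 2 %| y.
  by move=> y1; rewrite pfactor_dvdn //; case: y y1; rewrite ?logn0.
have [->|ne] := eqVneq z z'; first by [].
have lt : 0 < z' - z by rewrite subn_gt0 ltn_neqAle ne.
have d2 : 1 < logn p (z' - z) by rewrite -pfactor_dvdn // dvdn_sub ?dv.
have pz : ~~ (p %| 1 + z).
  rewrite dvdn_addl ?dvdn1 ?gtn_eqF ?prime_gt1 //.
  exact: dvdn_trans (dvdn_exp2l p (_ : 1 <= 2)) (dv _ z1).
move/esym/eqP: E; rewrite eqn_mod_dvd ?leq_exp2r ?leq_add2l //.
have z'E : 1 + z' = (1 + z) + (z' - z) by rewrite -addnA subnKC.
rewrite z'E pfactor_dvdn // ?logn_sub_expn // => [ce|]; last first.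
  by rewrite subn_gt0 ltn_exp2r // -[X in X < _]addn0 ltn_add2l.
apply/esym/eqP; rewrite eqn_mod_dvd ?leq_addr // addKn pfactor_dvdn //.
by rewrite leq_subLR addnC.
Qed.

(** The pair formed by the two eigenvalues 1 + z and 1 + p ^ 2 of a p-power of
    the acting element determines z: the valuations 3 and 2 rule out every way
    of matching it with the powers of the pair for z' except the identity, and
    then the common eigenvalue 1 + p ^ 2 forces the exponents to agree. *)
Lemma exponent_rigidity p N c (x z z' : nat -> nat) : prime p ->
    (forall k, logn p (z k) = 3) -> (forall k, logn p (z' k) = 3) ->
    (forall k, (1 + p ^ 2) ^ x k = (1 + p ^ 2) ^ (p ^ N) %[mod p ^ (k - c)]) \/
    (forall k, (1 + z' k) ^ x k = (1 + p ^ 2) ^ (p ^ N) %[mod p ^ (k - c)]) ->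
    (forall k, (1 + p ^ 2) ^ x k = (1 + z k) ^ (p ^ N) %[mod p ^ (k - c)]) \/
    (forall k, (1 + z' k) ^ x k = (1 + z k) ^ (p ^ N) %[mod p ^ (k - c)]) ->
  forall k, 1 + z k = 1 + z' k %[mod p ^ (k - (c + N))].
Proof.
move=> pp zv z'v E1 E0.
have p2 : logn p (p ^ 2) = 2 by rewrite pfactorK.
have tr (a b y t : nat) k f : f <= k - c ->
    (1 + a) ^ y = (1 + b) ^ t %[mod p ^ (k - c)] ->
    (p ^ f %| (1 + a) ^ y - 1) = (p ^ f %| (1 + b) ^ t - 1).
  move=> fk E; rewrite -!eqn_mod_dvd ?expn_gt0 //.
  by rewrite -(modn_dvdm ((1 + a) ^ y) (dvdn_exp2l p fk)) E modn_dvdm ?dvdn_exp2l.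
pose k0 := c + (N + 4); have fk : N + 3 <= k0 - c by rewrite addKn; lia.
have big m n : (p ^ m %| p ^ n) = (m <= n) by rewrite dvdn_Pexp2l ?prime_gt1.
have w3 : (p ^ (N + 3) %| (1 + p ^ 2) ^ (p ^ N) - 1) = false.
  by rewrite dvdn_expn_sub1 ?p2 // big; lia.
have u3 : p ^ (N + 3) %| (1 + z k0) ^ (p ^ N) - 1.
  by rewrite dvdn_expn_sub1 ?zv // big; lia.
case: E1 => E1; case: E0 => E0.
- by move: w3; rewrite -(tr _ _ _ _ _ _ fk (E1 k0)) (tr _ _ _ _ _ _ fk (E0 k0)) u3.
- move=> k.
  suff /eqmod_expn_base : (1 + z k) ^ (p ^ N) = (1 + z' k) ^ (p ^ N) %[mod p ^ (k - c)].
    by rewrite subnDA pfactorK // zv z'v expn_gt0 prime_gt0 //; apply.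
  rewrite -E0; apply/eqP; rewrite expn_eqmod ?z'v //.
  have /eqP := E1 k; rewrite expn_eqmod ?p2 // => /eqP E.
  have le : k - c - 3 <= k - c - 2 by apply: leq_sub2l.
  by rewrite -(modn_dvdm (x k) (dvdn_exp2l p le)) E modn_dvdm ?dvdn_exp2l.
- have := u3; rewrite -(tr _ _ _ _ _ _ fk (E0 k0)) dvdn_expn_sub1 ?p2 // => px.
  move: w3; rewrite -(tr _ _ _ _ _ _ fk (E1 k0)) dvdn_expn_sub1 ?z'v //.
  by rewrite (dvdn_trans _ px) // big; lia.
- by move: w3; rewrite -(tr _ _ _ _ _ _ fk (E1 k0)) (tr _ _ _ _ _ _ fk (E0 k0)) u3.
Qed.

Import GRing.Theory.

Local Open Scope classical_set_scope.
Local Open Scope group_scope.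
Local Open Scope card_scope.

(** * Subgroups, homomorphisms and words *)

Section AbstractGroupFacts.

Lemma is_subgroupP (G : groupType) (H : set G) :
  is_subgroup H <-> H 1 /\ forall x y, H x -> H y -> H (x * y^-1).
Proof.
split=> [[H1 HD]|[H1 HD]]; split.
- exact/set_mem.
- by move=> x y Hx Hy; apply/set_mem/HD; apply/mem_set.
- exact/mem_set.
- by move=> x y /set_mem Hx /set_mem Hy; apply/mem_set/HD.
Qed.

Section SubgroupOps.
Variables (G : groupType) (H : set G).
Hypothesis sH : is_subgroup H.

Lemma subgroup_one : H 1. Proof. by case/is_subgroupP: sH. Qed.

Lemma subgroup_div x y : H x -> H y -> H (x * y^-1).
Proof. by case/is_subgroupP: sH => _; apply. Qed.

Lemma subgroup_inv x : H x -> H x^-1.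
Proof. by move=> Hx; rewrite -[x^-1]mul1g; apply: subgroup_div subgroup_one Hx. Qed.

Lemma subgroup_mul x y : H x -> H y -> H (x * y).
Proof. by move=> Hx Hy; rewrite -[y]invgK; apply: subgroup_div Hx (subgroup_inv Hy). Qed.

Lemma subgroup_exp x n : H x -> H (x ^+ n).
Proof.
move=> Hx; elim: n => [|n IHn]; first exact: subgroup_one.
by rewrite expgS; apply: subgroup_mul.
Qed.

Lemma subgroup_word (X : Type) (x : X -> G) (w : seq (X * bool)) :
  (forall a, H (x a)) -> H (word_value x w).
Proof.
move=> Hx; rewrite /word_value; elim: w => [|[a b] w IHw].
  by rewrite big_nil; apply: subgroup_one.
rewrite big_cons; apply: subgroup_mul => //=.
by case: b => //; apply: subgroup_inv.
Qed.

End SubgroupOps.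

Lemma bigcap_subgroup (G : groupType) (C : set (set G)) :
  (forall H, C H -> is_subgroup H) -> is_subgroup (\bigcap_(H in C) H).
Proof.
move=> sC; apply/is_subgroupP; split=> [H CH|x y Hx Hy H CH].
  exact: subgroup_one (sC _ CH).
by apply: (subgroup_div (sC _ CH)); [apply: Hx | apply: Hy].
Qed.

Lemma generated_subgroup_subgroup (G : groupType) (A : set G) :
  is_subgroup (generated_subgroup A).
Proof. by apply: bigcap_subgroup => H [sH _]. Qed.

Lemma sub_generated (G : groupType) (A : set G) : A `<=` generated_subgroup A.
Proof. by move=> x Ax H [_]; apply. Qed.

Lemma generated_sub (G : groupType) (A H : set G) :
  is_subgroup H -> A `<=` H -> generated_subgroup A `<=` H.
Proof. by move=> sH AH x; apply; split. Qed.

Section HomFacts.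
Variables (G K : groupType) (f : G -> K).
Hypothesis hf : is_hom f.

Lemma hom1 : f 1 = 1.
Proof. by apply: (@mulgI _ (f 1)); rewrite -hf !mulg1. Qed.

Lemma homV x : f x^-1 = (f x)^-1.
Proof. by apply: (@mulgI _ (f x)); rewrite -hf !mulgV hom1. Qed.

Lemma homX x n : f (x ^+ n) = f x ^+ n.
Proof. by elim: n => [|n IHn]; rewrite ?hom1 // !expgS hf IHn. Qed.

Lemma homJ x y : f (x ^ y) = f x ^ f y.
Proof. by rewrite !conjgE !hf homV. Qed.

Lemma homR x y : f [~ x, y] = [~ f x, f y].
Proof. by rewrite !commgEl hf homV homJ. Qed.

Lemma hom_word (X : Type) (x : X -> G) w :
  f (word_value x w) = word_value (f \o x) w.
Proof.
rewrite /word_value; elim: w => [|[a b] w IHw].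
  by rewrite !big_nil hom1.
by rewrite !big_cons hf IHw /=; case: b => //=; rewrite homV.
Qed.

Lemma kernel_normal : is_normal_subgroup (hom_kernel f).
Proof.
split=> [|x g]; rewrite /hom_kernel /=.
  apply/is_subgroupP; split=> /=; first exact: hom1.
  by move=> x y fx fy; rewrite hf homV fx fy mulgV.
by move=> fx; rewrite homJ fx conj1g.
Qed.

Lemma preimage_subgroup (H : set K) : is_subgroup H -> is_subgroup (f @^-1` H).
Proof.
move=> sH; apply/is_subgroupP; split; first by rewrite /= hom1; apply: subgroup_one.
by move=> x y /= Hx Hy; rewrite hf homV; apply: subgroup_div.
Qed.

Lemma image_subgroup (H : set G) : is_subgroup H -> is_subgroup (f @` H).
Proof.
move=> sH; apply/is_subgroupP; split; first by exists 1; [apply: subgroup_one|apply: hom1].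
by move=> _ _ [x Hx <-] [y Hy <-]; exists (x * y^-1);
  [apply: subgroup_div | rewrite hf homV].
Qed.

End HomFacts.

Lemma hom_comp (G H K : groupType) (f : G -> H) (g : H -> K) :
  is_hom f -> is_hom g -> is_hom (g \o f).
Proof. by move=> hf hg x y /=; rewrite hf hg. Qed.

Lemma word_value_cat (X : Type) (G : groupType) (x : X -> G) w1 w2 :
  word_value x (w1 ++ w2) = word_value x w1 * word_value x w2.
Proof. exact: big_cat. Qed.

Definition word_inv (X : Type) (w : seq (X * bool)) : seq (X * bool) :=
  rev [seq (a.1, ~~ a.2) | a <- w].

Lemma word_value_inv (X : Type) (G : groupType) (x : X -> G) w :
  word_value x (word_inv w) = (word_value x w)^-1.
Proof.
rewrite /word_value; elim: w => [|[a b] w IHw].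
  by rewrite !big_nil invg1.
rewrite /word_inv /= rev_cons -cats1 big_cat /= IHw !big_cons big_nil mulg1 invgM.
by case: b; rewrite //= invgK.
Qed.

Lemma word_value1 (X : Type) (G : groupType) (x : X -> G) a :
  word_value x [:: (a, false)] = x a.
Proof. by rewrite /word_value big_cons big_nil mulg1. Qed.

Definition words (X : Type) (G : groupType) (x : X -> G) : set G :=
  range (word_value x).

Lemma words_subgroup (X : Type) (G : groupType) (x : X -> G) :
  is_subgroup (words x).
Proof.
apply/is_subgroupP; split; first by exists nil => //; rewrite /word_value big_nil.
move=> _ _ [w1 _ <-] [w2 _ <-]; exists (w1 ++ word_inv w2) => //.
by rewrite word_value_cat word_value_inv.
Qed.

Lemma words_gen (X : Type) (G : groupType) (x : X -> G) a : words x (x a).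
Proof. by exists [:: (a, false)] => //; rewrite word_value1. Qed.

Lemma words_generated (X : Type) (G : groupType) (x : X -> G) :
  words x = generated_subgroup (range x).
Proof.
apply/seteqP; split; last first.
  have xw : range x `<=` words x by move=> _ [a _ <-]; exact: (words_gen x a).
  exact: generated_sub (words_subgroup x) xw.
move=> _ [w _ <-]; apply: (subgroup_word (generated_subgroup_subgroup _)) => a.
by apply: sub_generated; exists a.
Qed.

End AbstractGroupFacts.

(** * Closed subgroups of products of finite groups *)

(** The closure, in the product of the groups P i, of the subgroup generated by
    the family x: approximation by words on finite sets of coordinates is
    membership in the closure for the product topology. *)
Record limit_group (X : Type) (I : eqType) (P : I -> finGroupType)
    (x : forall i, X -> P i) := LimitGroup {
  coordinate :> forall i, P i;
  coord_closed : forall l : seq I, exists w : seq (X * bool),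
    forall i, i \in l -> coordinate i = word_value (x i) w
}.

Section LimitGroup.
Variables (X : Type) (I : eqType) (P : I -> finGroupType).
Variable (x : forall i, X -> P i).
Local Notation L := (limit_group x).

Lemma coord_inj (f g : L) : (forall i, f i = g i) -> f = g.
Proof.
case: f g => [f fP] [g gP] /= fg.
have {}fg : f = g by apply: functional_extensionality_dep.
by subst g; congr LimitGroup; apply: Prop_irrelevance.
Qed.

HB.instance Definition _ := gen_eqMixin L.
HB.instance Definition _ := gen_choiceMixin L.

Lemma limit_word_closed (w : seq (X * bool)) (l : seq I) :
  exists w' : seq (X * bool),
    forall i, i \in l -> word_value (x i) w = word_value (x i) w'.
Proof. by exists w. Qed.

Definition limit_one : L :=
  LimitGroup (limit_word_closed [::]).

Lemma limit_mul_closed (f g : L) (l : seq I) :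
  exists w : seq (X * bool),
    forall i, i \in l -> f i * g i = word_value (x i) w.
Proof.
have [[u fu] [v gv]] := (coord_closed f l, coord_closed g l).
by exists (u ++ v) => i il; rewrite word_value_cat fu // gv.
Qed.

Lemma limit_inv_closed (f : L) (l : seq I) :
  exists w : seq (X * bool),
    forall i, i \in l -> (f i)^-1 = word_value (x i) w.
Proof.
have [u fu] := coord_closed f l.
by exists (word_inv u) => i il; rewrite word_value_inv fu.
Qed.

Definition limit_mul (f g : L) : L := LimitGroup (limit_mul_closed f g).
Definition limit_inv (f : L) : L := LimitGroup (limit_inv_closed f).

Fact limit_mulA : associative limit_mul.
Proof. by move=> f g h; apply: coord_inj => i; apply: mulgA. Qed.
Fact limit_mul1 : left_id limit_one limit_mul.
Proof.
by move=> f; apply: coord_inj => i /=; rewrite /word_value big_nil mul1g.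
Qed.
Fact limit_1mul : right_id limit_one limit_mul.
Proof.
by move=> f; apply: coord_inj => i /=; rewrite /word_value big_nil mulg1.
Qed.
Fact limit_mulV : left_inverse limit_one limit_inv limit_mul.
Proof.
by move=> f; apply: coord_inj => i /=; rewrite /word_value big_nil mulVg.
Qed.
Fact limit_Vmul : right_inverse limit_one limit_inv limit_mul.
Proof.
by move=> f; apply: coord_inj => i /=; rewrite /word_value big_nil mulgV.
Qed.

HB.instance Definition _ := isGroup.Build L
  limit_mulA limit_mul1 limit_1mul limit_mulV limit_Vmul.

Lemma coordM i : is_hom (fun f : L => f i). Proof. by []. Qed.

Lemma coord_mul (f g : L) i : (f * g) i = f i * g i. Proof. by []. Qed.
Lemma coord_inv (f : L) i : f^-1 i = (f i)^-1. Proof. by []. Qed.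
Lemma coord1 i : (1 : L) i = 1.
Proof. exact: (hom1 (@coordM i)). Qed.

Definition limit_gen (a : X) : L := LimitGroup (limit_word_closed [:: (a, false)]).

Lemma limit_genE a i : limit_gen a i = x i a.
Proof. exact: word_value1. Qed.

Lemma coord_word i (w : seq (X * bool)) :
  word_value limit_gen w i = word_value (x i) w.
Proof.
rewrite (hom_word (@coordM i)); congr (word_value _ w).
by apply/funext => a; apply: limit_genE.
Qed.

Definition agree (l : seq I) (f : L) : set L :=
  [set g | forall i, i \in l -> g i = f i].

Lemma agree_word l f : exists w, agree l f (word_value limit_gen w).
Proof.
have [w fw] := coord_closed f l; exists w => i il.
by rewrite coord_word fw.
Qed.

Definition limit_nbhs (f : L) : set_system L := filter_from setT (agree^~ f).

HB.instance Definition _ := hasNbhs.Build L limit_nbhs.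

Lemma nbhs_agree (l : seq I) (f : L) : nbhs f (agree l f).
Proof. by exists l. Qed.

Fact limit_nbhs_filter (f : L) : ProperFilter (nbhs f).
Proof.
apply: filter_from_proper; last by move=> l _; exists f.
apply: filter_from_filter; first by exists nil.
move=> l k _ _; exists (l ++ k) => // g fg.
by split=> i il; apply: fg; rewrite mem_cat il ?orbT.
Qed.

Fact limit_nbhs_singleton (f : L) (A : set L) : nbhs f A -> A f.
Proof. by case=> l _; apply. Qed.

Fact limit_nbhs_nbhs (f : L) (A : set L) : nbhs f A -> nbhs f (nbhs^~ A).
Proof.
case=> l _ lA; exists l => // g gf; exists l => // h hg.
by apply: lA => i il; rewrite hg // gf.
Qed.

HB.instance Definition _ := Nbhs_isNbhsTopological.Build L
  limit_nbhs_filter limit_nbhs_singleton limit_nbhs_nbhs.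

Fact limit_mul_continuous : continuous (fun fg : L * L => fg.1 * fg.2).
Proof.
move=> [f g] A [l _ lA].
exists (agree l f, agree l g); first by split; apply: nbhs_agree.
by move=> [f' g'] [/= ff' gg']; apply: lA => i il /=; congr (_ * _);
  [apply: ff' | apply: gg'].
Qed.

Fact limit_inv_continuous : continuous (fun f : L => f^-1).
Proof.
move=> f A [l _ lA]; exists l => // g fg.
by apply: lA => i il; congr (_^-1); apply: fg.
Qed.

HB.instance Definition _ := isTopGroup.Build L
  limit_mul_continuous limit_inv_continuous.

Lemma open_agree (l : seq I) (f : L) : open (agree l f).
Proof.
rewrite openE => g gf; exists l => // h hg i il.
by rewrite hg // gf.
Qed.

Lemma limit_hausdorff : hausdorff_space L.
Proof.
move=> f g fg; apply: coord_inj => i.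
have [h [hf hg]] := fg _ _ (nbhs_agree [:: i] f) (nbhs_agree [:: i] g).
by rewrite -hf ?hg ?mem_head.
Qed.

(** For each coordinate an ultrafilter singles out one value, because the
    coordinate ranges over a finite set; these values form its limit. *)
Lemma limit_compact : compact [set: L].
Proof.
rewrite compact_ultra => F FU _.
have exg i : exists a : P i, F [set f | f i = a].
  have : F (\bigcup_(a in [set` enum (P i)]) [set f : L | f i = a]).
    by apply: filterS filterT => f _; exists (f i) => //=; rewrite mem_enum.
  elim: (enum (P i)) => [|a s IHs] Fs.
    by have [f [b]] := filter_ex Fs.
  have [|FN] := in_ultra_setVsetC [set f : L | f i = a] FU; first by exists a.
  apply: IHs; apply: filterS2 FN Fs => f /= fa [b /=].
  by rewrite inE => /orP[/eqP-> /fa //|bs fb]; exists b.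
pose g i := projT1 (cid (exg i)).
have Fg i : F [set f | f i = g i] := projT2 (cid (exg i)).
have Fl (l : seq I) : F [set f : L | forall i, i \in l -> f i = g i].
  elim: l => [|i l IHl]; first by apply: filterS filterT.
  apply: filterS2 (Fg i) IHl => f fi fl j.
  by rewrite inE => /orP[/eqP->|/fl].
have gP (l : seq I) : exists w : seq (X * bool),
    forall i, i \in l -> g i = word_value (x i) w.
  have [f fl] := filter_ex (Fl l); have [w fw] := coord_closed f l.
  by exists w => i il; rewrite -fl // fw.
exists (LimitGroup gP); split=> // A [l _ lA]; apply: filterS (Fl l) => f fg.
exact: lA.
Qed.

Lemma agree1_subgroup l : is_subgroup (agree l 1).
Proof.
apply/is_subgroupP; split=> [i il //|f g f1 g1 i il].
by rewrite coord_mul coord_inv f1 // g1 // coord1 mulgV.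
Qed.

(** Finitely many coordinates together take values in one finite p-group. *)
Lemma agree_kernel p (pP : forall i, p.-nat #|P i|) (l : seq I) :
  exists (Q : finGroupType) (h : L -> Q),
    [/\ is_hom h, p.-nat #|Q| & hom_kernel h = agree l 1].
Proof.
elim: l => [|i l [Q [h [hh pQ kh]]]].
  exists 'S_0, (fun=> 1); split=> [f g||]; rewrite ?mulg1 //.
    by rewrite card_Sn.
  by apply/seteqP; split.
exists (P i * Q)%type, (fun f : L => (f i, h f)); split.
- by move=> f g; rewrite hh.
- by rewrite card_prod pnatM pP.
- apply/seteqP; split=> f /=.
    case=> fi1 hf1 j.
    have fl1 : agree l 1 f by rewrite -kh.
    by rewrite inE => /orP[/eqP->|/fl1//]; rewrite fi1 coord1.
  move=> f1; congr (_, _); first by rewrite f1 ?mem_head // coord1.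
  have: agree l 1 f by move=> j jl; apply: f1; rewrite inE jl orbT.
  by rewrite -kh.
Qed.

End LimitGroup.

(** * Indices of subgroups *)

Section Cosets.
Variables (G : groupType) (N : set G).
Hypothesis sN : is_subgroup N.

Lemma left_cosetE (x y : G) : ([set x * h | h in N] y) = N (x^-1 * y).
Proof.
apply/propext; split=> [[h Nh <-]|Nxy]; first by rewrite mulKg.
by exists (x^-1 * y) => //; rewrite mulVKg.
Qed.

Lemma eq_left_coset (x y : G) :
  [set x * h | h in N] = [set y * h | h in N] <-> N (x^-1 * y).
Proof.
split=> [E|Nxy].
  by rewrite -left_cosetE E; exists 1; [apply: (subgroup_one sN) | rewrite mulg1].
apply/seteqP; split=> z; rewrite !left_cosetE => Nz.
  have -> : y^-1 * z = (x^-1 * y)^-1 * (x^-1 * z).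
    by rewrite invgM invgK -mulgA mulVKg.
  by apply: (subgroup_mul sN) => //; apply: (subgroup_inv sN).
by rewrite -[z in x^-1 * z](mulVKg y) mulgA; apply: (subgroup_mul sN).
Qed.

(** Any map whose fibres are the cosets of N can be used to count them. *)
Lemma card_left_cosets (T : finType) (D : {set T}) (idx : G -> T) :
    (forall g, idx g \in D) -> (forall t, t \in D -> exists g, idx g = t) ->
    (forall g h, idx g = idx h <-> N (g^-1 * h)) ->
  left_cosets N #= `I_#|D|.
Proof.
move=> idxD Didx idxP; rewrite (card_eqr card_II).
pose F (j : 'I_#|D|) := [set g | idx g = enum_val j].
have -> : left_cosets N = F @` [set: 'I_#|D|].
  apply/seteqP; split=> [_ [g _ <-]|_ [j _ <-]].
    exists (enum_rank_in (idxD g) (idx g)) => //.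
    rewrite /F enum_rankK_in //; apply/seteqP; split=> h; rewrite left_cosetE.
      by move=> /esym/idxP.
    by move=> /idxP.
  have [g gj] := Didx _ (enum_valP j); exists g => //.
  rewrite /F -gj; apply/seteqP; split=> h; rewrite left_cosetE.
    by move=> /idxP.
  by move=> /esym/idxP.
apply: inj_card_eq => i j _ _ /seteqP[Fij _].
have [g gi] := Didx _ (enum_valP i).
by apply: enum_val_inj; rewrite -gi; apply: Fij.
Qed.

Lemma left_cosets_index (n : nat) : left_cosets N #= `I_n ->
  exists2 idx : G -> 'I_n, (forall j, exists g, idx g = j)
    & forall g h, idx g = idx h <-> N (g^-1 * h).
Proof.
move=> /card_set_bijP[e [eI einj esurj]].
have eP g : e [set g * h | h in N] < n by apply: eI; exists g.
exists (fun g => Ordinal (eP g)) => [j|g h].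
  have [_ [g _ <-] gj] := esurj j (ltn_ord j).
  by exists g; apply: val_inj.
split=> [[/einj E]|/eq_left_coset E]; last by apply: val_inj; rewrite /= E.
by apply/eq_left_coset/E; apply/mem_set; [exists g | exists h].
Qed.

(** If the kernel of a homomorphism to a finite p-group lies in N, the index
    of N is that of its image, a power of p by Lagrange. *)
Lemma pgroup_index (p : nat) (Q : finGroupType) (f : G -> Q) :
  is_hom f -> p.-nat #|Q| -> hom_kernel f `<=` N ->
  exists k, left_cosets N #= `I_(p ^ k).
Proof.
move=> hf pQ kN.
pose im (H : set G) : {set Q} := [set y | `[< exists2 x, H x & f x = y >]]%SET.
have imP H y : reflect (exists2 x, H x & f x = y) (y \in im H).
  by rewrite inE; apply: asboolP.
have im_group H : is_subgroup H -> group_set (im H).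
  move=> sH; apply/group_setP; split.
    by apply/imP; exists 1; [apply: (subgroup_one sH) | apply: (hom1 hf)].
  move=> _ _ /imP[x Hx <-] /imP[y Hy <-].
  by apply/imP; exists (x * y); [apply: (subgroup_mul sH) | apply: hf].
have sT : is_subgroup [set: G] by apply/is_subgroupP.
pose S := Group (im_group _ sT); pose K := Group (im_group _ sN).
have KS : K \subset S.
  by apply/fintype.subsetP=> _ /imP[x _ <-]; apply/imP; exists x.
have : left_cosets N #= `I_#|lcosets K S|.
  apply: (card_left_cosets (idx := fun g => f g *: K)) => [g|C|g h].
  - by apply/lcosetsP; exists (f g) => //; apply/imP; exists g.
  - by case/lcosetsP=> _ /imP[g _ <-] ->; exists g.
  have -> : f g *: K = f h *: K <-> f h \in f g *: K.
    by split=> [->|/lcoset_eqP//]; apply: lcoset_refl.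
  rewrite mem_lcoset -(homV hf) -hf; split=> [/imP[x Nx fx]|Ngh]; last first.
    by apply/imP; exists (g^-1 * h).
  rewrite -[g^-1 * h](mulVKg x); apply: (subgroup_mul sN) => //; apply: kN.
  by rewrite /hom_kernel /= hf (homV hf) fx mulVg.
rewrite card_lcosets.
have /p_natP[k ->] : p.-nat #|S : K|; last by exists k.
by apply: pnat_dvd pQ; rewrite -cardsT; apply: dvdn_trans (dvdn_indexg _ _) _;
  apply: cardSg (finset.subsetT S).
Qed.

End Cosets.

(** * Topological and pro-p groups *)

Section TopologicalGroups.
Variable G : topGroupType.

Lemma mulg_cvg (x y : G) (A : set G) : nbhs (x * y) A ->
  exists2 B, nbhs x B & exists2 C, nbhs y C & forall b c, B b -> C c -> A (b * c).
Proof.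
move=> nA; have [[B C] /= [nB nC] BC] := @mulg_continuous G (x, y) A nA.
by exists B => //; exists C => // b c Bb Cc; apply: (BC (b, c)).
Qed.

Lemma nbhs_mull (x y : G) (A : set G) :
  nbhs (x * y) A -> nbhs y [set z | A (x * z)].
Proof.
move=> /mulg_cvg[B nB [C nC BC]]; apply: filterS nC => c Cc.
exact: BC (nbhs_singleton nB) Cc.
Qed.

Lemma nbhs_mulr (x y : G) (A : set G) :
  nbhs (x * y) A -> nbhs x [set z | A (z * y)].
Proof.
move=> /mulg_cvg[B nB [C nC BC]]; apply: filterS nB => b Bb.
exact: BC Bb (nbhs_singleton nC).
Qed.

Lemma nbhs1_mull (x : G) (A : set G) :
  nbhs x A <-> nbhs 1 [set z | A (x * z)].
Proof.
split=> [nA|nA]; first by apply: nbhs_mull; rewrite mulg1.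
have : nbhs (x^-1 * x) [set z | A (x * z)] by rewrite mulVg.
by move=> /nbhs_mull; apply: filterS => y /=; rewrite mulVKg.
Qed.

Lemma nbhs_conjg (x g : G) (A : set G) : nbhs (x ^ g) A ->
  \forall x' \near x & g' \near g, A (x' ^ g').
Proof.
rewrite conjgE => /mulg_cvg[B nB [C /mulg_cvg[D nD [E nE DE]] BC]].
have nB' : nbhs g [set z | B z^-1] by apply: (@invg_continuous G g B).
exists (D, E `&` [set z | B z^-1]); first by split=> //; apply: filterI.
move=> [x' g'] [/= Dx [Eg Bg]]; rewrite conjgE; apply: BC => //.
exact: DE.
Qed.

Lemma subgroup_open (H : set G) : is_subgroup H -> nbhs 1 H -> open H.
Proof.
move=> sH nH; rewrite openE => x Hx; apply/nbhs1_mull.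
by apply: filterS nH => y Hy; apply: (subgroup_mul sH).
Qed.

Lemma open_nbhs1 (H : set G) : is_subgroup H -> open H -> nbhs 1 H.
Proof. by move=> sH oH; apply: open_nbhs_nbhs; split=> //; apply: subgroup_one. Qed.

Lemma nbhs_coset (H : set G) (x : G) :
  is_subgroup H -> open H -> nbhs x [set y | H (x^-1 * y)].
Proof.
move=> sH oH; apply/nbhs1_mull; apply: filterS (open_nbhs1 sH oH) => y.
by rewrite /= mulKg.
Qed.

(** The core of an open subgroup is still a neighbourhood of 1: by compactness
    one neighbourhood of 1 is conjugated into H by all elements at once. *)
Lemma open_normal_core (H : set G) :
    compact [set: G] -> is_subgroup H -> open H ->
  exists M : set G, [/\ open M, is_normal_subgroup M & M `<=` H].
Proof.
move=> cG sH oH; pose M := [set x | forall g, H (x ^ g)].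
have nM : is_normal_subgroup M.
  split=> [|x g Mx h]; last by rewrite -conjgM.
  apply/is_subgroupP; split=> [g|x y Mx My g].
    by rewrite conj1g; apply: (subgroup_one sH).
  by rewrite conjMg conjVg; apply: (subgroup_div sH).
exists M; split=> //; last by move=> x /(_ 1); rewrite conjg1.
apply: subgroup_open (nM.1) _.
move/compact_near_coveringP: cG => /(_ _ (nbhs (1 : G)) (fun x g => H (x ^ g))).
move=> near1; apply: filterS (near1 _ _).
  by move=> x Hx g; apply: Hx.
move=> g _; have : nbhs (1 ^ g) H by rewrite conj1g; apply: open_nbhs1.
move=> /nbhs_conjg[[A B] /= [nA nB] AB]; exists (B, A) => //= -[g' x'] [/= Bg Ax].
exact: (AB (x', g')).
Qed.

End TopologicalGroups.

Section ProPFacts.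
Variables (p : nat) (G : topGroupType).
Hypothesis pG : is_pro_p p G.

Lemma pro_p_open_normal (A : set G) : nbhs 1 A ->
  exists M : set G, [/\ open M, is_normal_subgroup M & M `<=` A].
Proof.
case: pG => cG _ basis _ /basis[H [oH sH HA]].
have [M [oM nM MH]] := open_normal_core cG sH oH.
by exists M; split=> // x /MH/HA.
Qed.

Lemma pro_p_separated (x y : G) :
  (forall M, open M -> is_normal_subgroup M -> M (x^-1 * y)) -> x = y.
Proof.
move=> Mxy; case: pG => _ hG _ _; apply: hG => A B /nbhs1_mull nA nB.
have [M [oM nM MA]] := pro_p_open_normal nA.
exists y; split; last exact: nbhs_singleton nB.
by have := MA _ (Mxy M oM nM); rewrite /= mulVKg.
Qed.

End ProPFacts.

Section ContinuousHoms.
Variables (G K : topGroupType).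

Lemma hom_continuous (f : G -> K) : is_hom f ->
  (forall A, nbhs 1 A -> nbhs 1 (f @^-1` A)) -> continuous f.
Proof.
move=> hf f1 x A /nbhs1_mull /f1 nA; apply/nbhs1_mull.
by apply: filterS nA => y /=; rewrite hf.
Qed.

Lemma eq_continuous_hom (f g : G -> K) (A : set G) :
    hausdorff_space K -> is_hom f -> is_hom g -> continuous f -> continuous g ->
    closure (generated_subgroup A) = [set: G] -> {in A, f =1 g} -> f = g.
Proof.
move=> hK hf hg cf cg dA fgA; apply/funext => x; apply: hK => B C nB nC.
have Bx : nbhs x (f @^-1` B) by apply: cf.
have Cx : nbhs x (g @^-1` C) by apply: cg.
have : closure (generated_subgroup A) x by rewrite dA.
move=> /(_ _ (filterI Bx Cx))[y [Ay [/= By Cy]]].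
have sE : is_subgroup [set z | f z = g z].
  apply/is_subgroupP; split=> /= [|z t /= ez et]; first by rewrite !hom1.
  by rewrite hf hg (homV hf) (homV hg) ez et.
have AE : A `<=` [set z | f z = g z] by move=> z /mem_set/fgA.
by exists (f y); split=> //; rewrite (generated_sub sE AE Ay).
Qed.

End ContinuousHoms.

Section LimitProP.
Variables (X : Type) (I : eqType) (P : I -> finGroupType).
Variable (x : forall i, X -> P i).
Local Notation L := (limit_group x).

Lemma limit_gen_dense : closure (generated_subgroup (range (limit_gen x))) = [set: L].
Proof.
apply/seteqP; split=> // f _ A [l _ lA]; rewrite -words_generated.
by have [w fw] := agree_word l f; exists (word_value (limit_gen x) w); split;
  [exists w | apply: lA].
Qed.

Lemma nbhs1_agree (A : set L) : nbhs (1 : L) A -> exists l, agree l 1 `<=` A.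
Proof. by case=> l _ lA; exists l. Qed.

Lemma limit_pro_p (p : nat) : (forall i, p.-nat #|P i|) -> is_pro_p p L.
Proof.
move=> pP; split; [exact: limit_compact|exact: limit_hausdorff| |].
  move=> U /nbhs1_agree[l lU]; exists (agree l 1).
  by split; [apply: open_agree|apply: agree1_subgroup|].
move=> N oN nN; have [l lN] := nbhs1_agree (open_nbhs1 nN.1 oN).
have [Q [h [hh pQ kh]]] := agree_kernel x pP l.
by apply: (pgroup_index nN.1 hh pQ); rewrite kh.
Qed.

End LimitProP.

(** * Free pro-p groups *)

(** A group law on 'I_n.  Up to isomorphism every finite group has this form,
    and the laws on all the 'I_n form a small enough type to index a product. *)
Record group_table (n : nat) := GroupTable {
  table_mul : 'I_n -> 'I_n -> 'I_n;
  table_one : 'I_n;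
  table_inv : 'I_n -> 'I_n;
  table_mulA : associative table_mul;
  table_mul1 : left_id table_one table_mul;
  table_mulV : left_inverse table_one table_inv table_mul
}.

Definition table_group (n : nat) (t : group_table n) : Type := 'I_n.

HB.instance Definition _ (n : nat) (t : group_table n) :=
  Finite.on (table_group t).
HB.instance Definition _ (n : nat) (t : group_table n) :=
  Finite_isGroup.Build (table_group t)
    (table_mulA t) (table_mul1 t) (table_mulV t).

Lemma quotient_table (G : groupType) (N : set G) (n : nat) :
    is_normal_subgroup N -> left_cosets N #= `I_n ->
  exists (t : group_table n) (q : G -> table_group t),
    is_hom q /\ hom_kernel q = N.
Proof.
move=> [sN nN] /(left_cosets_index sN)[idx surj idxP].
have idxM g g' h h' : idx g = idx g' -> idx h = idx h' ->
    idx (g * h) = idx (g' * h').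
  move=> /idxP Ng /idxP Nh; apply/idxP.
  have -> : (g * h)^-1 * (g' * h') = (g^-1 * g') ^ h * (h^-1 * h').
    by rewrite conjgE invgM -!mulgA mulVKg.
  by apply: (subgroup_mul sN) => //; apply: nN.
pose rep j := projT1 (cid (surj j)).
have repK j : idx (rep j) = j := projT2 (cid (surj j)).
pose mul i j := idx (rep i * rep j).
have mulE g h : idx (g * h) = mul (idx g) (idx h) by apply: idxM; rewrite repK.
have mulA : associative mul.
  by move=> i j k; rewrite -[i]repK -[j]repK -[k]repK -!mulE mulgA.
have mul1 : left_id (idx 1) mul.
  by move=> i; rewrite -[i]repK -mulE mul1g.
have mulV : left_inverse (idx 1) (fun i => idx (rep i)^-1) mul.
  by move=> i; rewrite -[i in mul _ i]repK -mulE mulVg.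
exists (GroupTable mulA mul1 mulV), idx; split; first by move=> g h; apply: mulE.
apply/seteqP; split=> g /=.
  by rewrite /hom_kernel /= => /esym/idxP; rewrite invg1 mul1g.
by move=> Ng; apply/esym/idxP; rewrite invg1 mul1g.
Qed.

Section FreeProP.
Variables (p : nat) (X : finType).
Hypothesis p_prime : prime p.

(** The finite p-groups marked by a map from X, each isomorphism type occurring
    at least once: they index the product in which the free pro-p group lives. *)
Record marked_table := MarkedTable {
  mt_exp : nat;
  mt_table : group_table (p ^ mt_exp);
  mt_mark : X -> table_group mt_table
}.

Definition table_of (i : {classic marked_table}) : finGroupType :=
  table_group (mt_table i).
Definition mark_of (i : {classic marked_table}) : X -> table_of i := mt_mark i.

Definition free_pro_p : topGroupType := limit_group mark_of.
Definition free_gen : X -> free_pro_p := limit_gen mark_of.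

Lemma card_table (i : {classic marked_table}) : #|table_of i| = (p ^ mt_exp i)%N.
Proof. exact: card_ord. Qed.

Lemma table_pgroup (i : {classic marked_table}) :
  p.-nat #|table_of i|.
Proof. by rewrite card_table pnatX pnat_id. Qed.

Lemma free_pro_p_pro_p : is_pro_p p free_pro_p.
Proof. exact: (limit_pro_p mark_of table_pgroup). Qed.

Lemma finite_quotient (G : topGroupType) (f : X -> G) (M : set G) :
    is_pro_p p G -> open M -> is_normal_subgroup M ->
  exists (i : marked_table) (q : G -> table_group (mt_table i)),
    [/\ is_hom q, hom_kernel q = M & q \o f = mt_mark i].
Proof.
move=> [_ _ _ idx] oM nM; have [k /quotient_table-/(_ nM)[t [q [hq kq]]]] := idx M oM nM.
by exists (MarkedTable (q \o f)), q.
Qed.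

(** The image of an element of the free group is pinned down modulo each open
    normal subgroup by one of its coordinates; compactness of the target
    provides a point with all these residues. *)
Lemma free_pro_p_exists (G : topGroupType) (f : X -> G) : is_pro_p p G ->
  exists phi : free_pro_p -> G, [/\ is_hom phi, continuous phi & phi \o free_gen = f].
Proof.
move=> pG; pose quo (i : marked_table) (q : G -> table_group (mt_table i)) :=
  [/\ is_hom q, open (hom_kernel q) & q \o f = mt_mark i].
pose J := {i & {q | quo i q}}.
pose res (u : free_pro_p) (g : G) := forall i q, quo i q -> q g = u i.
have quo_nbhs i q g : quo i q -> nbhs g [set h | q h = q g].
  move=> [hq oq _]; have [sq _] := kernel_normal hq.
  apply: filterS (nbhs_coset g sq oq) => h; rewrite /hom_kernel /= hq (homV hq).
  by move=> /(canRL (mulKg _)); rewrite invgK mulg1.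
have res_exists u : exists g, res u g.
  pose B (l : seq {classic J}) :=
    [set g : G | forall j, j \in l -> projT1 (projT2 j) g = u (projT1 j)].
  have FB : ProperFilter (filter_from setT B).
    apply: filter_from_proper.
      apply: filter_from_filter; first by exists nil.
      move=> l k _ _; exists (l ++ k) => // g gB.
      by split=> j jl; apply: gB; rewrite mem_cat jl ?orbT.
    move=> l _; have [w wu] := coord_closed u (map (@projT1 _ _) l).
    exists (word_value f w) => j jl; rewrite wu; last by apply: map_f.
    by case: j {jl} => i [q [hq _ qf]] /=; rewrite (hom_word hq) qf.
  have [cG _ _ _] := pG; have [|g [_ gB]] := cG _ FB; first by exists nil.
  exists g => i q iq; pose j : {classic J} := existT _ i (exist _ q iq).
  have Bj : filter_from setT B (B [:: j]) by exists [:: j].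
  have [h [hB <-]] := gB _ _ Bj (quo_nbhs i q g iq).
  by apply: (hB j); rewrite mem_head.
have res_uniq u g h : res u g -> res u h -> g = h.
  move=> ug uh; apply: (pro_p_separated pG) => M oM nM.
  have [i [q [hq kq qf]]] := finite_quotient f pG oM nM.
  have iq : quo i q by split=> //; rewrite kq.
  by rewrite -kq /hom_kernel /= hq (homV hq) (ug i q iq) (uh i q iq) mulVg.
pose phi u := projT1 (cid (res_exists u)).
have phiP u : res u (phi u) := projT2 (cid (res_exists u)).
have hphi : is_hom phi.
  move=> u v; apply: (res_uniq (u * v)) => // i q iq.
  by have [hq _ _] := iq; rewrite hq !(phiP _ i q iq).
exists phi; split=> //.
  apply: (hom_continuous hphi) => A /(pro_p_open_normal pG)[M [oM nM MA]].
  have [i [q [hq kq qf]]] := finite_quotient f pG oM nM.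
  have iq : quo i q by split=> //; rewrite kq.
  exists [:: i : {classic marked_table}] => // u u1; apply: MA; rewrite -kq.
  by rewrite /hom_kernel /= (phiP u i q iq) u1 ?mem_head // coord1.
apply/funext => a /=; apply: (res_uniq (free_gen a)) => // i q iq.
have [_ _ qf] := iq.
by rewrite limit_genE /mark_of -qf.
Qed.

Lemma free_pro_p_free : is_free_pro_p p free_gen.
Proof.
split=> [|G f pG]; first exact: free_pro_p_pro_p.
have [phi [hphi cphi phif]] := free_pro_p_exists f pG.
exists phi; split=> // psi [hpsi cpsi psif].
have [_ hG _ _] := pG.
apply: (eq_continuous_hom hG hphi hpsi cphi cpsi (limit_gen_dense _)).
move=> _ /set_mem[a _ <-].
by have := congr1 (@^~ a) phif; rewrite -psif.
Qed.

End FreeProP.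

(** * p-adic powers *)

Lemma expg_eqmod (G : groupType) (g : G) (q m n : nat) :
  g ^+ q = 1 -> m = n %[mod q] -> g ^+ m = g ^+ n.
Proof.
move=> gq mn; rewrite (divn_eq m q) (divn_eq n q) mn.
by rewrite !expgnDr ![(_ * q)%N]mulnC !expgnA gq !expg1n.
Qed.

Lemma eqmod_tower (p : nat) (e : nat -> nat) :
    (forall k, e k.+1 = e k %[mod p ^ k]) ->
  forall j k, j <= k -> e k = e j %[mod p ^ j].
Proof.
move=> ee j k; elim: k => [|k IHk]; first by rewrite leqn0 => /eqP->.
rewrite leq_eqVlt => /orP[/eqP-> //|]; rewrite ltnS => jk.
by rewrite -IHk // -(modn_dvdm (e k.+1) (dvdn_exp2l p jk)) ee modn_dvdm ?dvdn_exp2l.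
Qed.

Section PadicPowers.
Variables (p : nat) (p_prime : prime p).
Variables (X : Type) (I : eqType) (P : I -> finGroupType).
Variable (x : forall i, X -> P i).
Hypothesis pP : forall i, p.-nat #|P i|.
Local Notation L := (limit_group x).

Lemma expg_card_pow i (a : P i) k : logn p #|P i| <= k -> a ^+ (p ^ k) = 1.
Proof.
move=> ik; have /p_natP[j cP] := pP i.
have aP : a ^+ (p ^ j) = 1.
  by rewrite -cP -cardsT; apply: expg_cardG; rewrite inE.
rewrite cP pfactorK // in ik.
by rewrite -(subnKC ik) expnD expgnA aP expg1n.
Qed.

(** c is the p-adic power of g whose exponent has residue e k modulo p ^ k. *)
Definition is_padic_power (e : nat -> nat) (g c : L) : Prop :=
  forall i k, logn p #|P i| <= k -> c i = g i ^+ e k.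

(** The coordinate at i only needs the exponent modulo the order of P i; on
    finitely many coordinates one residue of high precision serves them all, so
    the resulting point stays in the closure. *)
Lemma padic_power_exists (e : nat -> nat) (g : L) :
    (forall k, e k.+1 = e k %[mod p ^ k]) ->
  exists c, is_padic_power e g c.
Proof.
move=> ee; pose c i := g i ^+ e (logn p #|P i|).
have cE i k : logn p #|P i| <= k -> c i = g i ^+ e k.
  move=> ik; apply: expg_eqmod (expg_card_pow (g i) (leqnn _)) _.
  by rewrite (eqmod_tower ee ik).
suff cP (l : seq I) : exists w, forall i, i \in l -> c i = word_value (x i) w.
  by exists (LimitGroup cP).
pose K := \max_(i <- l) logn p #|P i|.
have [w gw] := coord_closed (g ^+ e K) l; exists w => i il; rewrite -gw //.
rewrite (homX (@coordM _ _ _ x i)) /=; apply: cE.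
exact: (@leq_bigmax_seq _ l xpredT (fun i => logn p #|P i|) i il).
Qed.

Lemma padic_power_close (e : nat -> nat) (g c : L) (A : set L) :
    is_padic_power e g c -> nbhs 1 A ->
  exists K, forall k, K <= k -> A ((g ^+ e k)^-1 * c).
Proof.
move=> gc /nbhs1_agree[l lA]; exists (\max_(i <- l) logn p #|P i|) => k Kk.
apply: lA => i il; rewrite coord1 coord_mul coord_inv (gc i k).
  by rewrite (homX (@coordM _ _ _ x i)) /= mulVg.
by apply: leq_trans Kk; apply: (@leq_bigmax_seq _ l xpredT (fun i => logn p #|P i|)).
Qed.

Lemma padic_power_hom (e : nat -> nat) (g c : L) (Q : groupType) (f : L -> Q) :
    is_padic_power e g c -> is_hom f -> open (hom_kernel f) ->
  exists K, forall k, K <= k -> f c = f g ^+ e k.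
Proof.
move=> gc hf of1; have [sf _] := kernel_normal hf.
have [K Kk] := padic_power_close gc (open_nbhs1 sf of1).
exists K => k /Kk; rewrite /hom_kernel /= hf (homV hf) (homX hf).
by move=> /(canRL (mulKg _)); rewrite invgK mulg1.
Qed.

End PadicPowers.

(** * The finite semidirect products *)

(** Units v_i in 1 + p Z_p, given by natural numbers v k i congruent to v_i
    modulo p ^ k.+1.  The shift makes every modulus at least p. *)
Record padic_units (p n : nat) := PadicUnits {
  unit_res :> nat -> 'I_n -> nat;
  unit_res_mod : forall k i, unit_res k.+1 i = unit_res k i %[mod p ^ k.+1];
  unit_res1 : forall k i, unit_res k i = 1 %[mod p]
}.

Lemma Zp_nat_eq (q m m' : nat) : 1 < q ->
  (m%:R%R = m'%:R%R :> 'Z_q) <-> (m = m' %[mod q]).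
Proof.
move=> q1; split=> [/(congr1 (fun z : 'Z_q => z : nat))|mm].
  by rewrite !val_Zp_nat.
by apply: val_inj; rewrite /= !val_Zp_nat.
Qed.

Section Level.
Variables (p n : nat).
Hypothesis p_prime : prime p.
Variables (v : padic_units p n) (k : nat).
Local Notation q := (p ^ k.+1)%N.

Lemma level_gt1 : 1 < q.
Proof. by rewrite -(exp1n k.+1) ltn_exp2r // prime_gt1. Qed.

Lemma unit_res_pow (i : 'I_n) j : v k i ^ (p ^ j) = 1 %[mod p ^ j.+1].
Proof.
have v1 : 0 < v k i.
  rewrite lt0n; apply/eqP=> v0; have := unit_res1 v k i.
  by rewrite v0 mod0n modn_small ?prime_gt1.
apply/eqP; elim: j => [|j IHj]; first by rewrite expn0 !expn1 unit_res1.
rewrite eqn_mod_dvd ?expn_gt0 ?v1 // [(p ^ j.+1)%N]expnSr expnM.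
apply: (@dvdn_pow_sub1 _ _ (v k i ^ (p ^ j) - 1)) => //.
  by rewrite -eqn_mod_dvd ?expn_gt0 ?v1.
by rewrite subnKC ?expn_gt0 ?v1.
Qed.

Definition unit_at (i : 'I_n) : 'Z_q := ((v k i)%:R)%R.

Lemma unit_at_pow i : (unit_at i ^+ q = 1)%R.
Proof.
rewrite /unit_at -natrX; apply/(Zp_nat_eq _ 1 level_gt1).
rewrite -(modn_dvdm _ (dvdn_exp2l p (leqnSn k.+1))) unit_res_pow.
by rewrite modn_dvdm // dvdn_exp2l.
Qed.

Lemma unit_at_exp_eqmod i a b : a = b %[mod q] -> (unit_at i ^+ a = unit_at i ^+ b)%R.
Proof.
move=> ab; rewrite (divn_eq a q) (divn_eq b q) ab.
by rewrite !exprD ![(_ * q)%N]mulnC !exprM unit_at_pow !expr1n.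
Qed.

End Level.

(** The finite quotients of the groups of the family: the semidirect product
    of (Z/q)^n by Z/q, for q = p^(k+1), whose generator scales the i-th
    coordinate by the unit v k i. *)
Definition level (p n : nat) (p_prime : prime p) (v : padic_units p n) (k : nat) : Type :=
  ('Z_(p ^ k.+1) * {ffun 'I_n -> 'Z_(p ^ k.+1)})%type.

Section LevelGroup.
Variables (p n : nat) (p_prime : prime p).
Variables (v : padic_units p n) (k : nat).
Local Notation q := (p ^ k.+1)%N.
Local Notation S := (level p_prime v k).

HB.instance Definition _ := Finite.on S.

Definition level_mul (a b : S) : S :=
  ((a.1 + b.1)%R, [ffun i => (a.2 i * unit_at v k i ^+ (b.1 : nat) + b.2 i)%R]).
Definition level_one : S := (0%R, [ffun => 0%R]).
Definition level_inv (a : S) : S :=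
  ((- a.1)%R, [ffun i => (- (a.2 i * unit_at v k i ^+ (- a.1)%R))%R]).

Lemma unit_at_add i (a b : 'Z_q) :
  (unit_at v k i ^+ (a + b)%R = unit_at v k i ^+ a * unit_at v k i ^+ b)%R.
Proof.
rewrite -exprD; apply: (unit_at_exp_eqmod p_prime).
rewrite -{1}[a]natr_Zp -{1}[b]natr_Zp -natrD val_Zp_nat ?modn_mod //.
exact: level_gt1.
Qed.

Fact level_mulA : associative level_mul.
Proof.
move=> a b c; congr (_, _); first exact: addrA.
by apply/ffunP => i; rewrite !ffunE /= unit_at_add mulrDl addrA mulrA.
Qed.

Fact level_mul1 : left_id level_one level_mul.
Proof.
case=> a f; congr (_, _); first exact: add0r.
by apply/ffunP => i; rewrite !ffunE /= mul0r add0r.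
Qed.

Fact level_mulV : left_inverse level_one level_inv level_mul.
Proof.
case=> a f; congr (_, _); first exact: addNr.
apply/ffunP => i; rewrite !ffunE /level_inv; cbn [fst snd].
by rewrite mulNr -mulrA -unit_at_add addNr mulr1 addNr.
Qed.

HB.instance Definition _ := Finite_isGroup.Build S level_mulA level_mul1 level_mulV.

Definition level_gen (a : option 'I_n) : S :=
  if a is Some i then (0%R, [ffun j => (j == i)%:R%R]) else (1%R, [ffun => 0%R]).

Lemma card_level : #|{: S}| = (q ^ n.+1)%N.
Proof. by rewrite card_prod card_ffun !card_ord Zp_cast ?level_gt1 // -expnS. Qed.

Lemma level_pgroup : p.-nat #|{: S}|.
Proof. by rewrite card_level !pnatX pnat_id. Qed.

Lemma level_mul1E (a b : S) : (a * b).1 = (a.1 + b.1)%R. Proof. by []. Qed.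
Lemma level_mul2E (a b : S) i :
  (a * b).2 i = (a.2 i * unit_at v k i ^+ (b.1 : nat) + b.2 i)%R.
Proof. by rewrite ffunE. Qed.

Lemma level_t_exp m : level_gen None ^+ m = (m%:R%R, [ffun => 0%R]) :> S.
Proof.
elim: m => [|m IHm] //; rewrite expgS IHm; congr (_, _); first by rewrite mulrS.
by apply/ffunP => i; rewrite !ffunE /= mul0r addr0.
Qed.

Definition translation (f : {ffun 'I_n -> 'Z_q}) : S := (0%R, f).

Lemma translationM f g :
  translation f * translation g = translation [ffun i => (f i + g i)%R].
Proof.
congr (_, _); first exact: addr0.
by apply/ffunP => i; rewrite !ffunE /= expr0 mulr1.
Qed.

Lemma translationX f m : translation f ^+ m = translation [ffun i => (f i *+ m)%R].
Proof.
elim: m => [|m IHm]; first by congr (_, _); apply/ffunP => i; rewrite !ffunE.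
rewrite expgS IHm translationM; congr translation.
by apply/ffunP => i; rewrite !ffunE mulrS.
Qed.

Lemma level_conj f (h : S) :
  translation f ^ h = translation [ffun i => (f i * unit_at v k i ^+ (h.1 : nat))%R].
Proof.
apply: (mulgI h); rewrite conjgE mulKVg.
congr (_, _) => /=; first by rewrite add0r addr0.
by apply/ffunP => i; rewrite !ffunE /= expr0 mulr1 addrC.
Qed.

End LevelGroup.

(** The relations of the semidirect product present it among the groups in which
    the generators have order dividing q: the map that sends the normal form
    t^x a_1^(y_1) ... a_n^(y_n) to the corresponding product is a homomorphism. *)
Section LevelHom.
Variables (p n : nat) (p_prime : prime p).
Variables (v : padic_units p n) (k : nat).
Local Notation q := (p ^ k.+1)%N.
Local Notation S := (level p_prime v k).
Variables (Q : groupType) (T : Q) (A : 'I_n -> Q).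
Hypothesis Tq : T ^+ q = 1.
Hypothesis Aq : forall i, A i ^+ q = 1.
Hypothesis AC : forall i j, commute (A i) (A j).
Hypothesis AT : forall i, A i ^ T = A i ^+ v k i.

Lemma expg_Zp_nat (g : Q) m : g ^+ q = 1 -> g ^+ (m%:R%R : 'Z_q) = g ^+ m.
Proof.
move=> gq; apply: (expg_eqmod gq).
by rewrite val_Zp_nat ?modn_mod ?level_gt1.
Qed.

Lemma conj_exp i m : A i ^ (T ^+ m) = A i ^+ (v k i ^ m)%N.
Proof.
elim: m => [|m IHm]; first by rewrite conjg1.
by rewrite expgSr conjgM IHm conjXg AT -expgnA -expnS.
Qed.

Definition level_hom (a : S) : Q := T ^+ (a.1 : nat) * \prod_i A i ^+ (a.2 i : nat).

Lemma level_homM : is_hom level_hom.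
Proof.
move=> a b; rewrite /level_hom.
have -> : T ^+ ((a * b).1 : nat) = T ^+ (a.1 : nat) * T ^+ (b.1 : nat).
  by rewrite level_mul1E -[a.1]natr_Zp -[b.1]natr_Zp -natrD !expg_Zp_nat // expgnDr.
have -> : \prod_i A i ^+ ((a * b).2 i : nat)
    = (\prod_i A i ^+ (a.2 i : nat)) ^ (T ^+ (b.1 : nat)) * \prod_i A i ^+ (b.2 i : nat).
  rewrite conjg_prod -prodgM_commute => [|i j _ _]; last first.
    by rewrite conjXg conj_exp -expgnA; apply: commuteX2; apply: AC.
  apply: eq_bigr => i _.
  rewrite level_mul2E conjXg conj_exp -expgnA -[a.2 i in LHS]natr_Zp.
  rewrite -[b.2 i in LHS]natr_Zp /unit_at -natrX -natrM -natrD expg_Zp_nat //.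
  by rewrite expgnDr mulnC.
rewrite -!mulgA; congr (_ * _); rewrite !mulgA; congr (_ * _).
by rewrite mulgV mul1g.
Qed.

Lemma level_hom_t : level_hom (level_gen p_prime v k None) = T.
Proof.
rewrite /level_hom /= big1 => [|i _]; last by rewrite ffunE expg0.
by rewrite mulg1; apply: (expg_Zp_nat 1 Tq).
Qed.

Lemma level_hom_a i : level_hom (level_gen p_prime v k (Some i)) = A i.
Proof.
rewrite /level_hom /= expg0 mul1g -[RHS](@big_pred1_eq _ 1 *%g _ i (fun=> A i)).
rewrite [RHS]big_mkcond; apply: eq_bigr => j _; rewrite ffunE /=.
rewrite -[A i]expg1.
by case: eqP => [->|_]; rewrite expg_Zp_nat.
Qed.

End LevelHom.

(** * Continuous homomorphisms of compact groups *)

Section Preliminaries.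

Lemma eq_hom_open_kernel (G : topGroupType) (K : groupType) (f g : G -> K) (A : set G) :
    is_hom f -> is_hom g -> open (hom_kernel f) -> open (hom_kernel g) ->
    closure (generated_subgroup A) = [set: G] -> {in A, f =1 g} -> f = g.
Proof.
move=> hf hg of1 og1 dA fgA; apply/funext => x.
have [[sf _] [sg _]] := (kernel_normal hf, kernel_normal hg).
have : closure (generated_subgroup A) x by rewrite dA.
move=> /(_ _ (filterI (nbhs_coset x sf of1) (nbhs_coset x sg og1))) [y [Ay []]].
have sE : is_subgroup [set z | f z = g z].
  apply/is_subgroupP; split=> /= [|z t /= ez et]; first by rewrite !hom1.
  by rewrite hf hg (homV hf) (homV hg) ez et.
have AE : A `<=` [set z | f z = g z] by move=> z /mem_set/fgA.
have /= fgy := generated_sub sE AE Ay.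
rewrite /hom_kernel /= hf hg (homV hf) (homV hg) -fgy.
move=> /(canRL (mulKg _)) fx /(canRL (mulKg _)) gx.
by move: gx; rewrite fx !invgK !mulg1.
Qed.

(** The saturation V of U is open, so its complement is compact; the image of
    that complement is closed, and it is the complement of the image of U. *)
Lemma compact_hom_open (G K : topGroupType) (f : G -> K) :
    compact [set: G] -> hausdorff_space K -> is_hom f -> continuous f ->
    range f = [set: K] ->
  forall U, open U -> open (f @` U).
Proof.
move=> cG hK hf cf rf U oU.
have oV : open (f @^-1` (f @` U)).
  rewrite openE => x [u Uu fu].
  have : nbhs (x * (x^-1 * u)) U by rewrite mulVKg; apply: open_nbhs_nbhs.
  move=> /nbhs_mulr; apply: filterS => y Uy; exists (y * (x^-1 * u)) => //.
  by rewrite !hf (homV hf) fu mulVg mulg1.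
have -> : f @` U = ~` (f @` (~` (f @^-1` (f @` U)))).
  apply/seteqP; split=> [_ [u Uu <-] [x Vx fx]|y Vy].
    by apply: Vx; exists u.
  have [x _ fx] : range f y by rewrite rf.
  by apply: contrapT => Uy; apply: Vy; exists x => //= -[u Uu]; rewrite fx => fu;
    apply: Uy; exists u.
apply: closed_openC; apply: (compact_closed hK).
apply: continuous_compact; first exact: continuous_subspaceT.
by apply: (subclosed_compact _ cG) => //; apply: open_closedC.
Qed.

Lemma hom_surjective (G K : topGroupType) (f : G -> K) (A : set K) :
    compact [set: G] -> hausdorff_space K -> is_hom f -> continuous f ->
    closure (generated_subgroup A) = [set: K] -> A `<=` range f ->
  range f = [set: K].
Proof.
move=> cG hK hf cf dA Af; apply/seteqP; split=> // y _.
have cl : closed (range f).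
  apply: (compact_closed hK); apply: continuous_compact cG.
  exact: continuous_subspaceT.
have sT : is_subgroup [set: G] by apply/is_subgroupP.
have gf : generated_subgroup A `<=` range f.
  exact: generated_sub (image_subgroup hf sT) Af.
have : closure (generated_subgroup A) y by rewrite dA.
by move=> /(closure_subset gf); rewrite -(closure_id _).1.
Qed.

(** Applied to the open normal subgroups N M, with M open and normal, the
    hypothesis puts x in the closure of N. *)
Lemma closed_normal_open (p : nat) (G : topGroupType) (N : set G) (x : G) :
    is_pro_p p G -> is_normal_subgroup N -> closed N ->
    (forall M, open M -> is_normal_subgroup M -> N `<=` M -> M x) -> N x.
Proof.
move=> pG [sN nN] cN Mx; apply: cN => U /nbhs1_mull /(pro_p_open_normal pG).
move=> [M [oM [sM nM] MU]].
pose NM := [set y | exists2 m, M m & N (y * m)].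
have sNM : is_subgroup NM.
  apply/is_subgroupP; split; first by exists 1; rewrite ?mulg1; apply: subgroup_one.
  move=> y z [m Mm Ny] [m' Mm' Nz].
  exists ((m^-1 * m') ^ (z * m')^-1)^-1.
    by apply: (subgroup_inv sM); apply: nM; apply: (subgroup_mul sM) => //;
      apply: (subgroup_inv sM).
  have -> : y * z^-1 * ((m^-1 * m') ^ (z * m')^-1)^-1 = (y * m) * (z * m')^-1.
    by rewrite conjgE !invgM !invgK !mulgA !(mulgVK, mulgKV, mulgK).
  exact: (subgroup_div sN).
have MNM : M `<=` NM.
  move=> m Mm; exists m^-1; first exact: (subgroup_inv sM).
  by rewrite mulgV; apply: (subgroup_one sN).
have NMx : NM x.
  apply: Mx => [||y Ny]; last by exists 1; rewrite ?mulg1 //; apply: subgroup_one.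
    exact: subgroup_open sNM (filterS MNM (open_nbhs1 sM oM)).
  split=> // y g [m Mm Ny]; exists (m ^ g); first exact: nM.
  by rewrite -conjMg; apply: nN.
have [m Mm Nxm] := NMx; exists (x * m); split=> //.
exact: MU.
Qed.

Lemma card_range (T : finType) (U : Type) (f : T -> U) :
  injective f -> range f #= `I_#|T|.
Proof.
move=> fI; rewrite (card_eqr card_II).
have -> : range f = (f \o enum_val) @` [set: 'I_#|T|].
  apply/seteqP; split=> [_ [t _ <-]|_ [j _ <-]]; last by exists (enum_val j).
  by exists (enum_rank t) => //=; rewrite enum_rankK.
by apply: inj_card_eq => i j _ _ /fI/enum_val_inj.
Qed.

Lemma card_finset_le (T : finType) (U : Type) (A : set U) (f : U -> T) (B : {set T}) n :
  A #= `I_n -> (forall y, y \in B -> exists2 x, A x & f x = y) -> #|B| <= n.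
Proof.
move=> An Bf; rewrite -card_le_II.
have cB : [set` B] #= `I_#|B|.
  rewrite (card_eqr card_II).
  have -> : [set` B] = enum_val @` [set: 'I_#|B|].
    apply/seteqP; split=> [y /= yB|_ [j _ <-]]; last exact: enum_valP.
    by exists (enum_rank_in yB y) => //; rewrite enum_rankK_in.
  by apply: inj_card_eq => i j _ _ /enum_val_inj.
rewrite -(card_le_eqr An) -(card_le_eql cB).
apply: card_le_trans (card_image_le f A); apply: subset_card_le => y /= yB.
by have [x Ax fx] := Bf y yB; exists x.
Qed.

End Preliminaries.

(** * The pro-p semidirect products *)

Section Family.
Variables (p n : nat) (p_prime : prime p) (v : padic_units p n).

Definition padic_semidirect : topGroupType :=
  limit_group (fun k : nat => level_gen p_prime v k).

Local Notation G := padic_semidirect.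

Definition semidirect_gen : option 'I_n -> G :=
  limit_gen (fun k : nat => level_gen p_prime v k).

Definition level_coord k (g : G) : level p_prime v k := coordinate g k.

Lemma level_coord_hom k : is_hom (level_coord k).
Proof. by []. Qed.

Lemma level_coord_gen k a : level_coord k (semidirect_gen a) = level_gen p_prime v k a.
Proof. exact: limit_genE. Qed.

Lemma semidirect_pro_p : is_pro_p p G.
Proof. by apply: limit_pro_p => k; apply: level_pgroup. Qed.

Lemma level_gen_inj k : injective (level_gen p_prime v k).
Proof.
have q1 := level_gt1 p_prime k.
have n01 : (1%R : 'Z_(p ^ k.+1)) <> 0%R by apply/eqP; apply: oner_neq0.
case=> [i|] [j|] // E.
have := congr1 (fun a : level p_prime v k => a.2 i) E.
by rewrite !ffunE eqxx; case: eqP => [-> //|_ /n01].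
Qed.

Lemma semidirect_gen_inj : injective semidirect_gen.
Proof.
by move=> a b /(congr1 (level_coord 0)); rewrite !level_coord_gen => /level_gen_inj.
Qed.

Lemma level_gen_comm k i j :
  commute (level_gen p_prime v k (Some i)) (level_gen p_prime v k (Some j)).
Proof.
rewrite /commute !(translationM p_prime v); congr translation.
by apply/ffunP => l; rewrite !ffunE addrC.
Qed.

Lemma level_t_val k : (level_gen p_prime v k None).1 = 1%N :> nat.
Proof.
change (((1%:R)%R : 'Z_(p ^ k.+1)) = 1%N :> nat).
by rewrite val_Zp_nat ?modn_small // level_gt1.
Qed.

Lemma level_gen_conj k i :
  level_gen p_prime v k (Some i) ^ level_gen p_prime v k None
    = level_gen p_prime v k (Some i) ^+ v k i.
Proof.
rewrite [LHS]level_conj translationX; congr translation.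
apply/ffunP => j; rewrite !ffunE level_t_val expr1.
by case: eqP => [->|]; rewrite ?mul1r ?mul0r ?mul0rn.
Qed.

Lemma semidirect_generated : topologically_generated_by G n.+1.
Proof.
exists (range semidirect_gen); last exact: limit_gen_dense.
by have := card_range semidirect_gen_inj; rewrite card_option card_ord.
Qed.

Lemma level_normal_form k (x : nat) (y : 'I_n -> nat) :
  level_gen p_prime v k None ^+ x * \prod_i level_gen p_prime v k (Some i) ^+ y i
    = (x%:R%R, [ffun i => (y i)%:R%R]).
Proof.
pose F i : {ffun 'I_n -> 'Z_(p ^ k.+1)} := [ffun j => ((j == i)%:R *+ y i)%R].
have -> : \prod_i level_gen p_prime v k (Some i) ^+ y i
    = translation p_prime v (\sum_i F i)%R.
  have tM : {morph translation p_prime v (k := k) : f g / (f + g)%R >-> f * g}.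
    by move=> f g; rewrite translationM; congr translation.
  rewrite (big_morph _ tM (erefl _)); apply: eq_bigr => i _.
  rewrite [LHS]translationX; congr translation.
  by apply/ffunP => j; rewrite !ffunE.
rewrite level_t_exp; congr (_, _); first by rewrite /= addr0.
apply/ffunP => i; rewrite ffunE /= !ffunE mul0r add0r sum_ffunE (bigD1 i) //=.
rewrite ffunE eqxx big1 ?addr0 // => j ji.
by rewrite ffunE eq_sym (negPf ji) mul0rn.
Qed.

Lemma level_decomposition k (a : level p_prime v k) :
  a = level_gen p_prime v k None ^+ (a.1 : nat)
      * \prod_i level_gen p_prime v k (Some i) ^+ (a.2 i : nat).
Proof.
rewrite level_normal_form natr_Zp; case: a => x f; congr (_, _).
by apply/ffunP => i; rewrite ffunE natr_Zp.
Qed.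

(** Level 0 has modulus p, and the units are 1 modulo p: the action is trivial. *)
Lemma level0_abelem : p.-abelem [set: level p_prime v 0]%SET.
Proof.
have act1 i (x : 'Z_(p ^ 1)) : (unit_at v 0 i ^+ (x : nat) = 1)%R.
  have -> : unit_at v 0 i = 1%R.
    by apply/(Zp_nat_eq _ 1 (level_gt1 p_prime 0)); rewrite expn1 unit_res1.
  by rewrite expr1n.
have mulE (a b : level p_prime v 0) : a * b = ((a.1 + b.1)%R, (a.2 + b.2)%R).
  by congr (_, _); apply/ffunP => i; rewrite !ffunE act1 mulr1.
apply/abelemP => //; split.
  by apply/centsP=> a _ b _; rewrite /commute !mulE; congr (_, _); apply: addrC.
move=> a _.
have expE m : a ^+ m = ((a.1 *+ m)%R, (a.2 *+ m)%R).
  by elim: m => [|m IHm] //; rewrite expgS mulE IHm !mulrS.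
have p0 : (p%:R = 0 :> 'Z_(p ^ 1))%R.
  by apply/(Zp_nat_eq _ 0 (level_gt1 p_prime 0)); rewrite expn1 modnn mod0n.
rewrite expE; congr (_, _); first by rewrite -mulr_natr p0 mulr0.
by apply/ffunP => i; rewrite !ffunE ffunMnE -mulr_natr p0 mulr0.
Qed.

(** Level 0 is an elementary abelian quotient of rank n + 1, which bounds the
    number of generators from below. *)
Lemma semidirect_min_generators : min_generators G n.+1.
Proof.
split=> [|m [A Am dA]]; first exact: semidirect_generated.
pose E := level p_prime v 0.
pose B : {set E} := [set y | `[< exists2 g, A g & level_coord 0 g = y >]]%SET.
have BE : <<B>> = [set: E]%SET.
  have sB : is_subgroup [set g : G | level_coord 0 g \in <<B>>].
    apply: (preimage_subgroup (@level_coord_hom 0) (H := [set y | y \in <<B>>])).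
    by apply/is_subgroupP; split=> [|y z yB zB]; rewrite /= ?group1 // groupM ?groupV.
  have genB a : level_gen p_prime v 0 a \in <<B>>.
    have : closure (generated_subgroup A) (semidirect_gen a) by rewrite dA.
    move=> /(_ _ (nbhs_agree [:: 0] _))[g [Ag ga]].
    rewrite -level_coord_gen /level_coord -ga ?mem_head //.
    apply: (generated_sub sB _ Ag) => h Ah /=; apply: mem_gen.
    by rewrite inE; apply/asboolP; exists h.
  apply/eqP; rewrite finset.eqEsubset finset.subsetT; apply/fintype.subsetP => y _.
  rewrite [y]level_decomposition groupM ?groupX //.
  by apply: group_prod => i _; apply: groupX.
have mB : #|B| <= m.
  apply: (card_finset_le (f := level_coord 0) Am) => y.
  by rewrite inE => /asboolP.
apply: leq_trans mB; apply: leq_trans (grank_min B).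
rewrite BE grank_abelian ?(abelem_abelian level0_abelem) //.
rewrite (rank_abelem level0_abelem) cardsT card_level.
by rewrite expn1 pfactorK.
Qed.

Lemma unit_res_le i j k : j <= k -> v k i = v j i %[mod p ^ j.+1].
Proof.
elim: k => [|k IHk]; first by rewrite leqn0 => /eqP->.
rewrite leq_eqVlt => /orP[/eqP-> //|]; rewrite ltnS => jk.
have d : p ^ j.+1 %| p ^ k.+1 by rewrite dvdn_exp2l.
by rewrite -IHk // -(modn_dvdm (v k.+1 i) d) unit_res_mod modn_dvdm.
Qed.

Lemma level_gen_order k i : level_gen p_prime v k (Some i) ^+ (p ^ k.+1) = 1.
Proof.
rewrite translationX; congr (_, _); apply/ffunP => j; rewrite !ffunE.
rewrite -[LHS]mulr_natr (_ : ((p ^ k.+1)%N%:R = 0 :> 'Z_(p ^ k.+1))%R) ?mulr0 //.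
by apply/(Zp_nat_eq _ 0 (level_gt1 p_prime k)); rewrite modnn mod0n.
Qed.

Lemma level_t_order k : level_gen p_prime v k None ^+ (p ^ k.+1) = 1.
Proof.
rewrite level_t_exp; congr (_, _).
by apply/(Zp_nat_eq _ 0 (level_gt1 p_prime k)); rewrite modnn mod0n.
Qed.

(** The levels form an inverse system: truncating the coordinates of a point
    of the limit from one level to a lower one recovers its lower coordinate. *)
Lemma level_coord_trunc j k (g : G) i : j <= k ->
  (level_coord k g).2 i = (level_coord j g).2 i %[mod p ^ j.+1].
Proof.
move=> jk.
pose h := level_hom (p_prime := p_prime) (v := v) (k := k)
  (level_gen p_prime v j None) (fun i => level_gen p_prime v j (Some i)).
have ord a : level_gen p_prime v j a ^+ (p ^ k.+1) = 1.
  have jk1 : j.+1 <= k.+1 by [].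
  rewrite -(subnKC jk1) expnD expgnA.
  by case: a => [a|]; rewrite ?level_gen_order ?level_t_order expg1n.
have conj i' : level_gen p_prime v j (Some i') ^ level_gen p_prime v j None
    = level_gen p_prime v j (Some i') ^+ v k i'.
  rewrite level_gen_conj; apply: (expg_eqmod (level_gen_order j i')).
  by rewrite (unit_res_le i' jk).
have hh : is_hom h by apply: level_homM => // i' j'; apply: level_gen_comm.
have -> : level_coord j g = h (level_coord k g).
  have [w gw] := coord_closed g [:: j; k].
  rewrite /level_coord !gw ?inE ?eqxx ?orbT // (hom_word hh); congr (word_value _ w).
  apply/funext => a /=; rewrite /h.
  by case: a => [a|]; rewrite ?level_hom_a ?level_hom_t.
by rewrite /h /level_hom level_normal_form ffunE val_Zp_nat ?modn_mod ?level_gt1.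
Qed.

End Family.

(** * Finite presentation *)

Section FinitePresentation.
Variables (p n : nat) (p_prime : prime p) (v : padic_units p n).
Local Notation G := (padic_semidirect p_prime v).
Local Notation F := (free_pro_p p (option 'I_n)).
Local Notation gen := (@free_gen p (option 'I_n)).

Lemma closed_kernel (H K : topGroupType) (f : H -> K) :
  hausdorff_space K -> continuous f -> closed (hom_kernel f).
Proof.
move=> hK cf; apply: (closed_comp (f := f)) => [x _|]; first exact: cf.
exact: accessible_closed_set1 (hausdorff_accessible hK) _.
Qed.

(** c i stands for the p-adic power of the i-th generator by the unit v_i. *)
Definition relators (c : 'I_n -> F) : set F :=
  [set [~ gen (Some ij.1), gen (Some ij.2)] | ij in [set: 'I_n * 'I_n]]
  `|` [set (gen (Some i) ^ gen None)^-1 * c i | i in [set: 'I_n]].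

Lemma level_coord_kernel_open k : open (hom_kernel (@level_coord p n p_prime v k)).
Proof.
have -> : hom_kernel (@level_coord p n p_prime v k) = agree [:: k] (1 : G).
  apply/seteqP; split=> g /= gk => [j|].
    rewrite inE => /eqP->; rewrite [g k]gk.
    by rewrite -(hom1 (@level_coord_hom p n p_prime v k)).
  rewrite /hom_kernel /= /level_coord gk ?mem_head //.
  exact: (hom1 (@level_coord_hom p n p_prime v k)).
exact: open_agree.
Qed.

Lemma unit_res_tower i k : v k.+1 i = v k i %[mod p ^ k].
Proof.
by rewrite -(modn_dvdm (v k.+1 i) (dvdn_exp2l p (leqnSn k))) unit_res_mod
  modn_dvdm // dvdn_exp2l.
Qed.

(** Let f be in the kernel of the map phi from the free group onto G, and M an
    open normal subgroup that contains the relators.  The finite quotient by M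
    satisfies, for k large, the relations of level k, so the quotient map factors
    through phi and f lies in M.  As M varies, f lies in the closed normal closure
    of the relators. *)
Lemma semidirect_finitely_presented : finitely_presented_pro_p p G.
Proof.
have pF : is_pro_p p F := free_pro_p_pro_p _ p_prime.
have pG : is_pro_p p G := semidirect_pro_p p_prime v.
have [cF _ _ _] := pF; have [_ hG _ _] := pG.
have exc i : exists c, is_padic_power p (fun k => v k i) (gen (Some i)) c.
  apply: padic_power_exists => //; first exact: table_pgroup.
  exact: unit_res_tower.
pose c i := projT1 (cid (exc i)).
have cP i : is_padic_power p (fun k => v k i) (gen (Some i)) (c i) := projT2 (cid (exc i)).
have [phi [hphi cphi phigen]] := free_pro_p_exists (@semidirect_gen p n p_prime v) pG.
have phiE a : phi (gen a) = semidirect_gen p_prime v a by rewrite -phigen.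
exists (option 'I_n), F, gen, (relators c); split; first exact: free_pro_p_free.
  rewrite /relators finite_setU; split; apply: finite_image; exact: finite_finset.
have rphi : range phi = [set: G].
  apply: (hom_surjective cF hG hphi cphi (limit_gen_dense _)).
  by move=> _ [a _ <-]; exists (gen a).
exists phi; split=> //; first exact: compact_hom_open cF hG hphi cphi rphi.
have coord_open k : open (hom_kernel (@level_coord p n p_prime v k \o phi)).
  by have /continuousP/(_ _ (@level_coord_kernel_open k)) := cphi.
have coord_hom k : is_hom (@level_coord p n p_prime v k \o phi).
  exact: hom_comp hphi (@level_coord_hom p n p_prime v k).
apply/seteqP; split=> [f kf N [[nN cN] AN]|].
  apply: (closed_normal_open pF nN cN) => M oM nM NM.
  have [i [q [hq kq qgen]]] := finite_quotient gen pF oM nM.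
  have oq : open (hom_kernel q) by rewrite kq.
  have qP x m : mt_exp i <= m -> q x ^+ (p ^ m) = 1.
    move=> im; apply: (expg_card_pow p_prime (@table_pgroup p (option 'I_n) p_prime)).
    by rewrite card_table pfactorK.
  pose K j := projT1 (cid (padic_power_hom (cP j) hq oq)).
  have KP j : forall k, K j <= k -> q (c j) = q (gen (Some j)) ^+ v k j :=
    projT2 (cid (padic_power_hom (cP j) hq oq)).
  pose k := maxn (mt_exp i) (\max_j K j).
  have ik : mt_exp i <= k.+1 by rewrite ltnW // ltnS leq_maxl.
  have qA r : relators c r -> q r = 1.
    by move=> Ar; have : hom_kernel q r by rewrite kq; apply/NM/AN.
  have AC j j' : commute (q (gen (Some j))) (q (gen (Some j'))).
    apply/commgP; rewrite -(homR hq); apply/eqP/qA; left; by exists (j, j').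
  have AT j : q (gen (Some j)) ^ q (gen None) = q (gen (Some j)) ^+ v k j.
    have := qA _ (or_intror (ex_intro2 _ _ j Logic.I (erefl _))).
    rewrite hq (homV hq) (homJ hq) (KP j k); last first.
      by apply: leq_trans (leq_maxr _ _); apply: leq_bigmax.
    by move=> /(canRL (mulKg _)); rewrite invgK mulg1.
  pose h := level_hom (p_prime := p_prime) (v := v) (k := k) (q (gen None))
    (fun j => q (gen (Some j))).
  have hh : is_hom h by apply: level_homM => // *; apply: qP.
  have hE : q = h \o (@level_coord p n p_prime v k \o phi).
    apply: (eq_hom_open_kernel hq (hom_comp (coord_hom k) hh) oq _ (limit_gen_dense _)).
      apply: subgroup_open (kernel_normal (hom_comp (coord_hom k) hh)).1 _.
      apply: filterS (open_nbhs1 (kernel_normal (coord_hom k)).1 (coord_open k)).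
      by move=> x; rewrite /hom_kernel /= => ->; apply: hom1 hh.
    move=> _ /set_mem[a _ <-] /=; rewrite phiE level_coord_gen.
    by case: a => [a|]; rewrite /h ?level_hom_a ?level_hom_t // => *; apply: qP.
  rewrite -kq /hom_kernel hE /= kf (hom1 (@level_coord_hom p n p_prime v k)).
  exact: hom1 hh.
apply: bigcap_inf; split; first by split; [exact: kernel_normal | exact: closed_kernel].
move=> r Ar; apply: coord_inj => k.
rewrite -[LHS]/((@level_coord p n p_prime v k \o phi) r).
rewrite -[RHS]/(level_coord k (1 : G)) (hom1 (@level_coord_hom p n p_prime v k)).
case: Ar => [[[i j] _ <-]|[i _ <-]].
  rewrite (homR (coord_hom k)) /= !phiE !level_coord_gen.
  by apply/eqP/commgP; apply: level_gen_comm.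
have [K Kc] := padic_power_hom (cP i) (coord_hom k) (coord_open k).
rewrite coord_hom (homV (coord_hom k)) (Kc (maxn K k)) ?leq_maxl //.
rewrite (homJ (coord_hom k)) /= !phiE !level_coord_gen level_gen_conj.
rewrite (expg_eqmod (level_gen_order p_prime v k i) (unit_res_le v i (leq_maxr K k))).
exact: mulVg.
Qed.

End FinitePresentation.

(** * Commensurations and eigenvalues *)

Lemma eqmod_cancel p Y A B a m : prime p -> ~~ (p ^ a.+1 %| Y)%N ->
  (Y * A = Y * B %[mod p ^ m] -> A = B %[mod p ^ (m - a)])%N.
Proof.
move=> pp; wlog AB : A B / (A <= B)%N => [W|] pY E.
  have [AB|/ltnW AB] := leqP A B; first exact: W AB pY E.
  exact/esym/(W _ _ AB pY)/esym.
move/esym/eqP: E; rewrite eqn_mod_dvd ?leq_mul2l ?AB ?orbT // -mulnBr => d.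
apply/esym/eqP; rewrite eqn_mod_dvd //.
have Y0 : (0 < Y)%N by case: Y pY {d} => //; rewrite dvdn0.
have [->|D0] := posnP (B - A); first exact: dvdn0.
move: d pY; rewrite !pfactor_dvdn ?muln_gt0 ?Y0 ?D0 // lognM //; lia.
Qed.

Section Elements.
Variables (p n : nat) (p_prime : prime p) (v : padic_units p n).
Local Notation G := (padic_semidirect p_prime v).
Local Notation lgen := (level_gen p_prime v).

(** The p-adic powers of the i-th generator, described by their coordinates. *)
Lemma translation_exists i (e : nat -> nat) :
    (forall k, e k.+1 = e k %[mod p ^ k.+1]) ->
  exists a : G, forall k, level_coord k a = lgen k (Some i) ^+ e k.
Proof.
move=> ee.
have ele j k : j <= k -> e k = e j %[mod p ^ j.+1].
  elim: k => [|k IHk]; first by rewrite leqn0 => /eqP->.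
  rewrite leq_eqVlt => /orP[/eqP-> //|]; rewrite ltnS => jk.
  have d : p ^ j.+1 %| p ^ k.+1 by rewrite dvdn_exp2l.
  by rewrite -IHk // -(modn_dvdm (e k.+1) d) ee modn_dvdm.
have ee' k : e k.+1 = e k %[mod p ^ k].
  by rewrite -(modn_dvdm (e k.+1) (dvdn_exp2l p (leqnSn k))) ee modn_dvdm // dvdn_exp2l.
have [a aP] := padic_power_exists p_prime (@level_pgroup p n p_prime v)
  (semidirect_gen p_prime v (Some i)) ee'.
exists a => k; rewrite /level_coord.
set m := maxn k (logn p #|{: level p_prime v k}|).
rewrite (aP k m) ?leq_maxr // -[X in X ^+ _]/(level_coord k (semidirect_gen p_prime v (Some i))).
rewrite level_coord_gen; apply: (expg_eqmod (level_gen_order p_prime v k i)).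
by rewrite ele ?leq_maxl.
Qed.

(** A neighbourhood of 1 constrains finitely many levels only. *)
Lemma open_contains_deep (H : set G) : is_subgroup H -> open H ->
  exists N, forall g, (forall k, k < N -> level_coord k g = 1) -> H g.
Proof.
move=> sH oH; have [l lH] := nbhs1_agree (open_nbhs1 sH oH).
exists (\max_(i <- l) i).+1 => g g1; apply: lH => k kl.
rewrite [RHS](hom1 (@level_coord_hom p n p_prime v k)); apply: g1.
by rewrite ltnS; apply: (@leq_bigmax_seq _ l xpredT id k kl).
Qed.

Lemma level_conj_exp k i D s :
  (lgen k (Some i) ^+ D) ^ (lgen k None ^+ s) = lgen k (Some i) ^+ (D * v k i ^ s).
Proof.
by rewrite conjXg (conj_exp (level_gen_conj p_prime v k)) -expgnA mulnC.
Qed.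

(** The quotient by the translations is Z/q, which is abelian. *)
Lemma level_commutator k (a b : level p_prime v k) :
  [~ a, b] = translation p_prime v [~ a, b].2.
Proof.
rewrite /translation -[0%R](_ : [~ a, b].1 = 0%R) -?surjective_pairing //.
rewrite commgEl conjgE !level_mul1E.
have inv1 (c : level p_prime v k) : c^-1.1 = (- c.1)%R by [].
by rewrite !inv1 [(a.1 + b.1)%R]addrC addKr addNr.
Qed.

Lemma level_eq (g h : G) : (forall k, level_coord k g = level_coord k h) -> g = h.
Proof. exact: coord_inj. Qed.

End Elements.

Section Commensurability.
Variables (p n : nat) (p_prime : prime p) (v v' : padic_units p n).
Local Notation G := (padic_semidirect p_prime v).
Local Notation G' := (padic_semidirect p_prime v').
Local Notation lgen := (level_gen p_prime v).

Hypothesis v_mono : forall k i, v k i <= v k.+1 i.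
Variable val : 'I_n -> nat.
Hypothesis v_val : forall k i, logn p (v k i - 1) = val i.
Hypothesis val_gt1 : forall i, 1 < val i.

(** A translation a of the i-th line and a power h of t lying in the domain of
    a commensuration f have a commutator on which h acts by the p-adic integer
    v i ^ s.  The image of that commutator is again a translation, and f is
    compatible with p-adic powers modulo every p ^ k; so f h multiplies the
    coordinates of the image by the same p-adic integer, and one of these
    coordinates is nonzero.  Cancelling it costs a bounded precision c. *)
Lemma commensurable_eigenvalues : commensurable G G' ->
  exists (N : nat) (x : nat -> nat), forall i, exists (j : 'I_n) (c : nat), forall k,
    v' k j ^ x k = v k i ^ (p ^ N) %[mod p ^ (k - c)].
Proof.
move=> [H [K [oH sH oK sK [f [g [fM [fHK _] [fgK _] _ _]]]]]].
have {}fM a b : H a -> H b -> f (a * b) = f a * f b.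
  by move=> Ha Hb; apply: fM; apply/mem_set.
have fI a b : H a -> H b -> f a = f b -> a = b.
  by move=> Ha Hb E; rewrite -[a]fgK ?E ?fgK //; apply/mem_set.
have f1 : f 1 = 1.
  apply: (@mulgI _ (f 1)).
  by rewrite -(fM _ _ (subgroup_one sH) (subgroup_one sH)) !mulg1.
have fV a : H a -> f a^-1 = (f a)^-1.
  move=> Ha; apply: (@mulgI _ (f a)).
  by rewrite -(fM _ _ Ha (subgroup_inv sH Ha)) !mulgV.
have fX a m : H a -> f (a ^+ m) = f a ^+ m.
  move=> Ha; elim: m => [|m IHm]; first exact: f1.
  by rewrite !expgS fM ?IHm //; apply: subgroup_exp.
have [N HN] := open_contains_deep sH oH; exists N.
set s := (p ^ N)%N.
have s_deep k : k < N -> p ^ k.+1 %| s by move=> kN; apply: dvdn_exp2l.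
pose h : G := semidirect_gen p_prime v None ^+ s.
have hE k : level_coord k h = lgen k None ^+ s.
  by rewrite /h (homX (@level_coord_hom p n p_prime v k)) level_coord_gen.
have Hh : H h.
  apply: HN => k /s_deep/dvdnP[d sd].
  by rewrite hE sd mulnC expgnA level_t_order expg1n.
exists (fun k => ((level_coord k (f h)).1 : nat)) => i.
have v_le k l : k <= l -> v k i <= v l i.
  elim: l => [|l IHl]; first by rewrite leqn0 => /eqP->.
  rewrite leq_eqVlt => /orP[/eqP-> //|]; rewrite ltnS => kl.
  exact: leq_trans (IHl kl) (v_mono l i).
have v_gt1 k : 1 < v k i.
  by rewrite -subn_gt0; case: (v k i - 1) (v_val k i) (val_gt1 i) => // <-; rewrite logn0.
pose w k := (v k i ^ s)%N.
have w_mod k l : k <= l -> w l = w k %[mod p ^ k.+1].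
  by move=> kl; rewrite /w -modnXm (unit_res_le v i kl) modnXm.
have s0 : 0 < s by rewrite expn_gt0 prime_gt0.
have w_le k l : k <= l -> w k <= w l by move=> /v_le; rewrite leq_exp2r.
have w0 k : 0 < w k by rewrite expn_gt0 ltnW.
pose D k := (s * (w k - 1))%N.
have D_mod k : D k.+1 = D k %[mod p ^ k.+1].
  apply/eqP; rewrite eqn_mod_dvd ?leq_mul2l ?leq_sub2r ?w_le ?orbT // -mulnBr.
  rewrite dvdn_mull // -subnDA subnKC // -eqn_mod_dvd ?w_le //.
  exact/eqP/w_mod.
pose is_translate (e : nat -> nat) (b : G) := [/\ H b,
  forall k, level_coord k b = lgen k (Some i) ^+ (e k * D k)
  & forall k, level_coord k (f b) = translation p_prime v' (level_coord k (f b)).2].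
have translate e : (forall k, e k.+1 = e k %[mod p ^ k.+1]) ->
    exists b, is_translate e b.
  move=> ee; have [|a aP] := translation_exists p_prime v i (e := fun k => (s * e k)%N).
    by move=> k; rewrite -modnMmr ee modnMmr.
  have Ha : H a.
    apply: HN => k /s_deep/dvdnP[d sd].
    by rewrite aP sd -mulnA mulnCA expgnA level_gen_order expg1n.
  have Hah : H (a ^ h).
    by rewrite conjgE; do 2?apply: (subgroup_mul sH) => //; apply: (subgroup_inv sH).
  exists [~ a, h]; split=> [|k|k].
  - by rewrite commgEl; apply: (subgroup_mul sH) => //; apply: (subgroup_inv sH).
  - rewrite (homR (@level_coord_hom p n p_prime v k)) aP hE commgEl level_conj_exp.
    rewrite -/(w k) -[w k in LHS](subnKC (w0 k)) mulnDr muln1 expgnDr mulKg.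
    by rewrite /D mulnCA mulnA.
  have -> : f [~ a, h] = [~ f a, f h].
    rewrite !commgEl fM ?fV //; last exact: (subgroup_inv sH).
    rewrite !conjgE !fM ?fV //; first exact: (subgroup_inv sH).
    exact: (subgroup_mul sH).
  by rewrite (homR (@level_coord_hom p n p_prime v' k)); apply: level_commutator.
have [b1 [Hb1 b1E fb1E]] := translate (fun=> 1%N) (fun=> erefl).
have [bw [Hbw bwE fbwE]] := translate w (fun k => w_mod k k.+1 (leqnSn k)).
have b1h : b1 ^ h = bw.
  apply: level_eq => k; rewrite (homJ (@level_coord_hom p n p_prime v k)).
  by rewrite b1E bwE hE level_conj_exp mul1n mulnC.
have fb1h : f b1 ^ f h = f bw.
  have Hhb : H (b1 * h) by apply: (subgroup_mul sH).
  have HhV : H h^-1 by apply: (subgroup_inv sH).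
  by rewrite -b1h !conjgE !fM // fV.
(* w = w k + q r with q = p ^ k.+1, and f turns the q-th power of the translate
   by r into a q-th power, which is invisible at level k. *)
have eigen k j : ((level_coord k (f b1)).2 j * (v' k j ^ (level_coord k (f h)).1)%N%:R
    = (level_coord k (f b1)).2 j * (w k)%:R)%R.
  pose r l := (w (l + k.+1) - w k) %/ p ^ k.+1.
  have rE l : (w k + p ^ k.+1 * r l = w (l + k.+1))%N.
    have kl : k <= l + k.+1 by rewrite addnS ltnW // ltnS leq_addl.
    rewrite /r mulnC divnK ?subnKC ?w_le // -eqn_mod_dvd ?w_le //.
    exact/eqP/w_mod.
  have r_mod l : r l.+1 = r l %[mod p ^ l.+1].
    have pk0 : 0 < p ^ k.+1 by rewrite expn_gt0 prime_gt0.
    have rl : r l <= r l.+1.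
      by rewrite -(leq_pmul2l pk0) -(leq_add2l (w k)) !rE w_le // leq_add2r.
    apply/eqP; rewrite eqn_mod_dvd // -(dvdn_pmul2l pk0) mulnBr -(subnDl (w k)) !rE.
    rewrite -expnD -eqn_mod_dvd ?w_le ?leq_add2r //.
    have -> : k.+1 + l.+1 = (l + k.+1).+1 by lia.
    by apply/eqP/w_mod; rewrite leq_add2r.
  have [br [Hbr brE fbrE]] := translate r r_mod.
  have bwE' : bw = b1 ^+ w k * br ^+ (p ^ k.+1).
    apply: level_eq => l; rewrite level_coord_hom.
    rewrite !(homX (@level_coord_hom p n p_prime v l)) b1E brE bwE -!expgnA -expgnDr.
    apply: (expg_eqmod (level_gen_order p_prime v l i)).
    have -> : (1 * D l * w k + r l * D l * p ^ k.+1 = D l * w (l + k.+1))%N.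
      by rewrite -rE; lia.
    by rewrite mulnC -modnMmr -(w_mod l (l + k.+1)) ?leq_addr // modnMmr.
  have : level_coord k (f b1 ^ f h) = level_coord k (f b1 ^+ w k * f br ^+ (p ^ k.+1)).
    rewrite fb1h bwE' fM ?fX //; exact: subgroup_exp.
  rewrite (homJ (@level_coord_hom p n p_prime v' k)) level_coord_hom.
  rewrite !(homX (@level_coord_hom p n p_prime v' k)) fb1E fbrE level_conj.
  rewrite !translationX translationM => /(congr1 (fun a : level p_prime v' k => a.2 j)).
  rewrite !ffunE /unit_at -natrX => ->.
  rewrite -[X in (_ + X)%R = _]mulr_natr.
  rewrite (_ : (p ^ k.+1)%N%:R%R = 0%R) ?mulr0 ?addr0 ?mulr_natr //.
  by apply/(Zp_nat_eq _ 0 (level_gt1 p_prime k)); rewrite modnn mod0n.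
have [k0 [j y0]] : exists k0 j, (level_coord k0 (f b1)).2 j <> 0%R.
  apply: contrapT => ny0.
  have fb1 : f b1 = 1.
    apply: level_eq => k; rewrite fb1E (hom1 (@level_coord_hom p n p_prime v' k)).
    congr (_, _); apply/ffunP => j; rewrite ffunE; apply: contrapT => y0.
    by apply: ny0; exists k, j.
  have b11 : b1 = 1 by apply: fI => //; [apply: subgroup_one | rewrite fb1 f1].
  (* D k has valuation N from s and val i + N from v ^ s - 1. *)
  pose k := (N + val i + N)%N.
  have := b1E k; rewrite b11 (hom1 (@level_coord_hom p n p_prime v k)) mul1n.
  rewrite translationX => /(congr1 (fun a : level p_prime v k => a.2 i)).
  rewrite !ffunE eqxx => /esym/(Zp_nat_eq _ 0 (level_gt1 p_prime k)).
  rewrite mod0n => /eqP; rewrite -/(dvdn _ _).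
  have vE : v k i = (1 + (v k i - 1))%N by rewrite subnKC // ltnW.
  have logw : logn p (w k - 1) = (val i + N)%N.
    have := @logn_sub_expn p 1 (v k i - 1) s p_prime.
    rewrite -vE exp1n /w v_val pfactorK // => -> //.
    - by rewrite dvdn1 gtn_eqF ?prime_gt1.
    - by rewrite subn_gt0.
  have w1 : 0 < w k - 1 by rewrite lt0n; apply/eqP => E; move: logw (val_gt1 i); rewrite E logn0; lia.
  rewrite pfactor_dvdn ?muln_gt0 ?s0 ?w1 // lognM // pfactorK // logw /k; lia.
exists j, k0 => k; have [kk0|k0k] := ltnP k k0.
  by rewrite (eqP (ltnW kk0 : k - k0 == 0)) expn0 !modn1.
have E : v' k j ^ (level_coord k (f h)).1 = w k %[mod p ^ (k.+1 - k0)].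
  apply: (@eqmod_cancel p ((level_coord k (f b1)).2 j) _ _ k0 k.+1) => //.
    rewrite /dvdn (level_coord_trunc (f b1) j k0k) -/(dvdn _ _).
    apply/negP => d; apply: y0; apply: val_inj => /=.
    have := ltn_ord ((level_coord k0 (f b1)).2 j).
    rewrite [X in _ < X]Zp_cast ?level_gt1 // => lt.
    by apply/eqP; rewrite -leqn0 leqNgt; apply/negP => /dvdn_leq/(_ d); rewrite leqNgt lt.
  have := eigen k j; rewrite -[((level_coord k (f b1)).2 j)]natr_Zp -!natrM.
  by move=> /(Zp_nat_eq _ _ (level_gt1 p_prime k)); rewrite natr_Zp.
have d : p ^ (k - k0) %| p ^ (k.+1 - k0) by rewrite dvdn_exp2l // leq_sub2r.
by rewrite -(modn_dvdm _ d) E modn_dvdm.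
Qed.

End Commensurability.

(** * The family indexed by binary sequences *)

Section EpsilonFamily.
Variables (p n : nat) (p_prime : prime p).

(** The residues of p^3 (1 + sum_j eps_j p^(j+1)).  The constant term keeps the
    valuation equal to 3 for every eps. *)
Definition digits (eps : nat -> bool) (k : nat) : nat :=
  p ^ 3 + \sum_(j < k) eps j * p ^ (j + 4).

Lemma digitsS eps k : digits eps k.+1 = digits eps k + eps k * p ^ (k + 4).
Proof. by rewrite /digits big_ord_recr addnA. Qed.

Lemma logn_digits eps k : logn p (digits eps k) = 3.
Proof.
suff [d ->] : exists d, digits eps k = (p ^ 3 * (1 + p * d))%N.
  have p0 : 0 < p ^ 3 by rewrite expn_gt0 prime_gt0.
  rewrite (lognM _ p0) // pfactorK // logn_coprime //.
  by rewrite prime_coprime // dvdn_addl ?dvdn_mulr // dvdn1 gtn_eqF ?prime_gt1.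
elim: k => [|k [d IHk]]; first by exists 0%N; rewrite /digits big_ord0 muln0 !addn0 muln1.
by exists (d + eps k * p ^ k)%N; rewrite digitsS IHk expnD expnS; lia.
Qed.

Lemma digits_mod eps j k : j <= k -> digits eps k = digits eps j %[mod p ^ (j + 4)].
Proof.
elim: k => [|k IHk]; first by rewrite leqn0 => /eqP->.
rewrite leq_eqVlt => /orP[/eqP-> //|]; rewrite ltnS => jk.
have jk4 : j + 4 <= k + 4 by rewrite leq_add2r.
rewrite digitsS -IHk // -modnDmr.
have /eqP-> : p ^ (j + 4) %| eps k * p ^ (k + 4) by rewrite dvdn_mull // dvdn_exp2l.
by rewrite addn0.
Qed.

Lemma digits_inj eps eps' d :
    (forall k, 1 + digits eps k = 1 + digits eps' k %[mod p ^ (k - d)]) ->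
  eps = eps'.
Proof.
move=> E; have E' j : digits eps j = digits eps' j %[mod p ^ (j + 4)].
  have le : j + 4 <= d + j + 4 - d by lia.
  have jd : j <= d + j + 4 by lia.
  rewrite -(digits_mod eps jd) -(digits_mod eps' jd).
  have := E (d + j + 4)%N => /eqP; rewrite eqn_modDl => /eqP {}E.
  by rewrite -(modn_dvdm _ (dvdn_exp2l p le)) E modn_dvdm // dvdn_exp2l.
suff eq_dig j : digits eps j = digits eps' j.
  apply/funext => j; have := eq_dig j.+1; rewrite !digitsS eq_dig => /addnI/eqP.
  by rewrite eqn_pmul2r ?expn_gt0 ?prime_gt0 //; case: (eps j); case: (eps' j).
elim: j => [|j IHj]; first by rewrite /digits !big_ord0.
rewrite !digitsS IHj; congr (_ + _ * _); apply/eqP.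
have /eqP := E' j.+1; rewrite !digitsS IHj eqn_modDl addSn expnS.
have pj : 0 < p ^ (j + 4) by rewrite expn_gt0 prime_gt0.
rewrite -!muln_modl eqn_pmul2r // !modn_small //.
  by case: (eps' j); rewrite ?prime_gt0 ?prime_gt1.
by case: (eps j); rewrite ?prime_gt0 ?prime_gt1.
Qed.

Definition family_res (eps : nat -> bool) (k : nat) (i : 'I_n) : nat :=
  (1 + if i == 0 :> nat then digits eps k else p ^ 2)%N.

Fact family_res_mod eps k i :
  family_res eps k.+1 i = family_res eps k i %[mod p ^ k.+1].
Proof.
rewrite /family_res; case: ifP => // _; apply/eqP; rewrite eqn_modDl; apply/eqP.
have le : k.+1 <= k + 4 by lia.
by rewrite -(modn_dvdm _ (dvdn_exp2l p le)) (digits_mod eps (leqnSn k)) modn_dvdm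
  ?dvdn_exp2l.
Qed.

Fact family_res1 eps k i : family_res eps k i = 1 %[mod p].
Proof.
apply/eqP; rewrite eqn_mod_dvd ?leq_addr // addKn; case: ifP => _; last exact: dvdn_exp.
by rewrite -[p in p %| _]expn1 pfactor_dvdn ?logn_digits // /digits addn_gt0 expn_gt0 prime_gt0.
Qed.

Definition family_units eps : padic_units p n :=
  PadicUnits (family_res_mod eps) (family_res1 eps).

Definition family_group (eps : nat -> bool) : topGroupType :=
  padic_semidirect p_prime (family_units eps).

Lemma family_commensurable eps eps' : 1 < n ->
  commensurable (family_group eps) (family_group eps') -> eps = eps'.
Proof.
move=> n1 /commensurable_eigenvalues.
move=> /(_ _ (fun i => if i == 0 :> nat then 3 else 2)) eigen.
have [||i|N [x {}eigen]] := eigen.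
- move=> k i; rewrite /= /family_res; case: ifP => // _.
  by rewrite leq_add2l digitsS leq_addr.
- move=> k i; rewrite /= /family_res addKn; case: ifP => _; first exact: logn_digits.
  exact: pfactorK.
- by case: ifP.
have n0 : 0 < n by apply: ltnW.
have [j0 [c0 E0]] := eigen (Ordinal n0).
have [j1 [c1 E1]] := eigen (Ordinal n1).
have weaken a b k c d : c <= d -> a = b %[mod p ^ (k - c)] -> a = b %[mod p ^ (k - d)].
  move=> cd E; have dv : p ^ (k - d) %| p ^ (k - c) by rewrite dvdn_exp2l // leq_sub2l.
  by rewrite -(modn_dvdm a dv) E modn_dvdm.
apply: (@digits_inj _ _ (maxn c0 c1 + N)).
apply: (@exponent_rigidity p N (maxn c0 c1) x) => //; try exact: logn_digits.
  have {}E1 k := weaken _ _ _ _ _ (leq_maxr c0 c1) (E1 k).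
  by move: E1; rewrite /= /family_res /=; case: (j1 == 0 :> nat) => E1; [right | left].
have {}E0 k := weaken _ _ _ _ _ (leq_maxl c0 c1) (E0 k).
by move: E0; rewrite /= /family_res /=; case: (j0 == 0 :> nat) => E0; [right | left].
Qed.

End EpsilonFamily.

(** Cantor's diagonal argument. *)
Lemma cantor_bool (h : (nat -> bool) -> nat) : ~ injective h.
Proof.
move=> hI; pose d k := `[< exists2 e, h e = k & e k = false >].
have dE : d (h d) <-> d (h d) = false.
  split=> [/asboolP[e /hI->] //|dF].
  by apply/asboolP; exists d.
by case: (d (h d)) dE => -[A B]; [have := A isT | have := B erefl].
Qed.

(** * Groups determined by finitely many words *)

(** The proof sH is a parameter so that the type carries the group structure. *)
Record subgroup_type (G : groupType) (H : set G) (sH : is_subgroup H) :=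
  SubgroupType { subgroup_val : G; subgroup_valP : H subgroup_val }.

Section SubgroupType.
Variables (G : groupType) (H : set G) (sH : is_subgroup H).
Local Notation S := (subgroup_type sH).

HB.instance Definition _ := gen_eqMixin S.
HB.instance Definition _ := gen_choiceMixin S.

Lemma subgroup_val_inj : injective (@subgroup_val G H sH).
Proof.
move=> [x Hx] [y Hy] /= xy; subst y; congr SubgroupType; exact: Prop_irrelevance.
Qed.

Definition subgroup_type_mul (x y : S) : S :=
  SubgroupType sH (subgroup_mul sH (subgroup_valP x) (subgroup_valP y)).
Definition subgroup_type_inv (x : S) : S :=
  SubgroupType sH (subgroup_inv sH (subgroup_valP x)).
Definition subgroup_type_one : S := SubgroupType sH (subgroup_one sH).

Fact subgroup_type_mulA : associative subgroup_type_mul.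
Proof. by move=> x y z; apply: subgroup_val_inj; apply: mulgA. Qed.
Fact subgroup_type_mul1 : left_id subgroup_type_one subgroup_type_mul.
Proof. by move=> x; apply: subgroup_val_inj; apply: mul1g. Qed.
Fact subgroup_type_1mul : right_id subgroup_type_one subgroup_type_mul.
Proof. by move=> x; apply: subgroup_val_inj; apply: mulg1. Qed.
Fact subgroup_type_mulV : left_inverse subgroup_type_one subgroup_type_inv subgroup_type_mul.
Proof. by move=> x; apply: subgroup_val_inj; apply: mulVg. Qed.
Fact subgroup_type_Vmul : right_inverse subgroup_type_one subgroup_type_inv subgroup_type_mul.
Proof. by move=> x; apply: subgroup_val_inj; apply: mulgV. Qed.

HB.instance Definition _ := isGroup.Build S subgroup_type_mulA subgroup_type_mul1
  subgroup_type_1mul subgroup_type_mulV subgroup_type_Vmul.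

Lemma subgroup_val_hom : is_hom (@subgroup_val G H sH).
Proof. by []. Qed.

End SubgroupType.

(** The words form a subgroup, so freeness provides a retraction onto it; it
    is the identity because it fixes the generators. *)
Lemma free_group_words (X : Type) (F : groupType) (i : X -> F) :
  is_free_group i -> forall x, words i x.
Proof.
move=> free x; pose sW := words_subgroup i.
pose iW (a : X) : subgroup_type sW := SubgroupType sW (words_gen i a).
have [r [[hr ri] _]] := free _ iW; have [u [[hu ui] uniq]] := free _ i.
have E : (@subgroup_val F (words i) sW) \o r = id.
  rewrite -[LHS](uniq _ _) -?[RHS](uniq _ _) //.
  split; first exact: hom_comp hr (@subgroup_val_hom _ _ sW).
  by rewrite -compA ri.
rewrite -[x](congr1 (@^~ x) E); exact: subgroup_valP.
Qed.

Lemma hom_factor (F G P : groupType) (phi : F -> G) (psi : F -> P) :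
    is_hom phi -> is_hom psi -> range phi = [set: G] ->
    hom_kernel phi `<=` hom_kernel psi ->
  exists2 theta : G -> P, is_hom theta & theta \o phi = psi.
Proof.
move=> hphi hpsi rphi ker.
have sec y : exists x, phi x = y.
  by have : range phi y; [rewrite rphi | case=> x _ <-; exists x].
pose s y := projT1 (cid (sec y)).
have sK y : phi (s y) = y := projT2 (cid (sec y)).
have eq_psi x y : phi x = phi y -> psi x = psi y.
  move=> E; have : hom_kernel psi (x^-1 * y).
    by apply: ker; rewrite /hom_kernel /= hphi (homV hphi) E mulVg.
  by rewrite /hom_kernel /= hpsi (homV hpsi) => /(canRL (mulKg _)); rewrite invgK mulg1.
exists (psi \o s); last by apply/funext => x /=; apply: eq_psi.
by move=> x y /=; rewrite -hpsi; apply: eq_psi; rewrite hphi !sK.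
Qed.

Definition presentation_code : Type := {k : nat & seq (seq ('I_k * bool))}.

HB.instance Definition _ := Countable.on presentation_code.

(** The universal property of the pro-p group presented by the words of c; it
    makes no reference to a free group, abstract or pro-p, and so applies alike
    to completions and to presentations. *)
Definition coded_by (p : nat) (c : presentation_code) (G : topGroupType) : Prop :=
  exists x : 'I_(projT1 c) -> G,
    (forall w, w \in projT2 c -> word_value x w = 1) /\
    forall (P : topGroupType) (f : 'I_(projT1 c) -> P), is_pro_p p P ->
      (forall w, w \in projT2 c -> word_value f w = 1) ->
      exists! phi : G -> P, [/\ is_hom phi, continuous phi & phi \o x = f].

(** Two groups with the same universal property are isomorphic. *)
Lemma coded_by_commensurable p c (G G' : topGroupType) :
  is_pro_p p G -> is_pro_p p G' -> coded_by p c G -> coded_by p c G' ->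
  commensurable G G'.
Proof.
move=> pG pG' [x [xc univ]] [x' [x'c univ']].
have [f [[hf cf fx] _]] := univ _ x' pG' x'c.
have [g [[hg cg gx] _]] := univ' _ x pG xc.
have gf : g \o f = id.
  have [u [_ uniq]] := univ _ x pG xc.
  have <- : u = g \o f.
    apply: uniq; split; first exact: hom_comp.
      by move=> t; apply: continuous_comp; [apply: cf | apply: cg].
    by rewrite -compA fx gx.
  by apply: uniq; split=> // t A.
have fg : f \o g = id.
  have [u [_ uniq]] := univ' _ x' pG' x'c.
  have <- : u = f \o g.
    apply: uniq; split; first exact: hom_comp.
      by move=> t; apply: continuous_comp; [apply: cg | apply: cf].
    by rewrite -compA gx fx.
  by apply: uniq; split=> // t A.
have sT (K : groupType) : is_subgroup [set: K] by apply/is_subgroupP.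
exists [set: G], [set: G']; split=> //; try exact: openT.
exists f, g; split.
- by move=> a b _ _; apply: hf.
- by split.
- split=> t _; first exact: (congr1 (fun h => h t) gf).
  exact: (congr1 (fun h => h t) fg).
- exact: continuous_subspaceT.
- exact: continuous_subspaceT.
Qed.

Lemma word_value_map (X Y : Type) (G : groupType) (h : X -> Y) (x : Y -> G) w :
  word_value x [seq (h a.1, a.2) | a <- w] = word_value (x \o h) w.
Proof. by rewrite /word_value big_map. Qed.

Definition rank_word (X : finType) (w : seq (X * bool)) : seq ('I_#|X| * bool) :=
  [seq (enum_rank a.1, a.2) | a <- w].

Lemma finite_words (X : finType) (F : groupType) (i : X -> F) (A : set F) :
    finite_set A -> (forall r, A r -> exists w, r = word_value i w) ->
  exists ws : seq (seq (X * bool)), A = word_value i @` [set` ws].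
Proof.
move=> /finite_seqP[s As] Aw.
pose W r : seq (X * bool) := if pselect (exists w, r = word_value i w) is left e
  then projT1 (cid e) else [::].
have WE r : A r -> word_value i (W r) = r.
  move=> /Aw e; rewrite /W; case: pselect => // e'.
  by rewrite -(projT2 (cid e')).
exists (map W s); apply/seteqP; split=> [r Ar|_ [_ /mapP[r rs ->] <-]].
  by exists (W r); [apply: map_f; rewrite As in Ar | apply: WE].
by rewrite WE // As.
Qed.

Lemma completion_coded (p : nat) (Gamma : groupType) (G : topGroupType) :
    finitely_presented_group Gamma -> is_pro_p_completion p Gamma G ->
  exists c, coded_by p c G.
Proof.
move=> [X [F [i [A [phi [free fA hphi rphi kphi]]]]]] [pG [j [hj univ]]].
have [|ws Aws] := finite_words (i := i) fA.
  by move=> r _; have [w _ <-] := free_group_words free r; exists w.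
exists (existT _ #|X| (map (@rank_word X) ws)), (j \o (phi \o (i \o enum_val))).
set x := j \o (phi \o (i \o enum_val)).
have xE : x \o enum_rank = (j \o phi) \o i.
  by apply/funext => a; rewrite /x /= enum_rankK.
have hjphi : is_hom (j \o phi) by apply: hom_comp.
split=> [_ /mapP[w wws ->]|P f pP fw] /=.
  rewrite word_value_map xE -(hom_word hjphi) /=.
  have : hom_kernel phi (word_value i w).
    by rewrite kphi => N [_]; apply; rewrite Aws; exists w.
  by rewrite /hom_kernel /= => ->; apply: hom1.
have [psi [[hpsi psii] uniq]] := free P (f \o enum_rank).
have ker : hom_kernel phi `<=` hom_kernel psi.
  rewrite kphi; apply: bigcap_inf; split; first exact: kernel_normal.
  rewrite Aws => _ [w wws <-]; rewrite /hom_kernel /= (hom_word hpsi) psii.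
  by rewrite -word_value_map; apply: fw; apply: map_f.
have [theta htheta thetaE] := hom_factor hphi hpsi rphi ker.
have [q [[hq cq qE] uniqq]] := univ P theta pP htheta.
exists q; split.
  split=> //; apply/funext => a.
  rewrite -[LHS]/((q \o j) (phi (i (enum_val a)))) qE.
  rewrite -[LHS]/((theta \o phi) (i (enum_val a))) thetaE.
  by rewrite -[LHS]/((psi \o i) (enum_val a)) psii /= enum_valK.
move=> q' [hq' cq' q'E]; apply: uniqq; split=> //.
have psiE : psi = (q' \o j) \o phi.
  apply: uniq; split; first by apply: hom_comp hphi (hom_comp hj hq').
  by apply/funext => a; rewrite -q'E /x /= enum_rankK.
apply/funext => y; have : range phi y by rewrite rphi.
case=> u _ <-; rewrite -[RHS]/((theta \o phi) u) thetaE psiE //.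
Qed.

Lemma finite_length_coded (p : nat) (G : topGroupType) :
  is_pro_p p G -> has_finite_length_presentation p G -> exists c, coded_by p c G.
Proof.
move=> pG [X [F [i [A [[[pF free] fA [phi [hphi cphi ophi rphi kphi]]] Aw]]]]].
have [ws Aws] := finite_words fA Aw.
exists (existT _ #|X| (map (@rank_word X) ws)), (phi \o (i \o enum_val)).
set x := phi \o (i \o enum_val).
have xE : x \o enum_rank = phi \o i.
  by apply/funext => a; rewrite /x /= enum_rankK.
split=> [_ /mapP[w wws ->]|P f pP fw] /=.
  rewrite word_value_map xE -(hom_word hphi).
  have : hom_kernel phi (word_value i w).
    by rewrite kphi => N [_]; apply; rewrite Aws; exists w.
  by [].
have [psi [[hpsi cpsi psii] uniq]] := free P (f \o enum_rank) pP.
have [_ hP _ _] := pP.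
have ker : hom_kernel phi `<=` hom_kernel psi.
  rewrite kphi; apply: bigcap_inf; split.
    by split; [exact: kernel_normal | exact: closed_kernel].
  rewrite Aws => _ [w wws <-]; rewrite /hom_kernel /= (hom_word hpsi) psii.
  by rewrite -word_value_map; apply: fw; apply: map_f.
have [theta htheta thetaE] := hom_factor hphi hpsi rphi ker.
have rangeE y : exists u, phi u = y.
  by have : range phi y; [rewrite rphi | case=> u _ <-; exists u].
exists theta; split.
  split=> //.
    apply/continuousP => U oU.
    have -> : theta @^-1` U = phi @` (psi @^-1` U).
      apply/seteqP; split=> [y Uy|_ [u Uu <-]].
        have [u uy] := rangeE y; exists u => //.
        by rewrite -thetaE /= uy.
      by rewrite /= -[theta (phi u)]/((theta \o phi) u) thetaE.
    by apply: ophi; move/continuousP: cpsi; apply.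
  apply/funext => a; rewrite -[LHS]/((theta \o phi) (i (enum_val a))) thetaE.
  by rewrite -[LHS]/((psi \o i) (enum_val a)) psii /= enum_valK.
move=> q [hq cq qE].
have psiE : psi = q \o phi.
  apply: uniq; split; first exact: hom_comp.
    by move=> u; apply: continuous_comp; [apply: cphi | apply: cq].
  by apply/funext => a; rewrite -qE /x /= enum_rankK.
apply/funext => y; have [u <-] := rangeE y.
by rewrite -[LHS]/((theta \o phi) u) thetaE psiE.
Qed.

Theorem corollary1p2 (p m : nat) (hp : prime p) (hm : 3 <= m) :
  exists (I : Type) (G : I -> topGroupType),
    [/\ ~ countable [set: I],
        (forall i j : I, i <> j -> ~ commensurable (G i) (G j)),
        (forall i : I, [/\ is_pro_p p (G i), finitely_presented_pro_p p (G i)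
                         & min_generators (G i) m]),
        (forall (i : I) (Gamma : groupType), finitely_presented_group Gamma ->
           ~ is_pro_p_completion p Gamma (G i))
      & (forall i : I, ~ has_finite_length_presentation p (G i))].
Proof.
case: m hm => [|n] // n1.
pose G (eps : nat -> bool) := family_group n hp eps.
have pG eps : is_pro_p p (G eps) by apply: semidirect_pro_p.
have G_inj eps eps' : commensurable (G eps) (G eps') -> eps = eps'.
  exact: family_commensurable.
pose I := {eps : nat -> bool | ~ exists c, coded_by p c (G eps)}.
exists I, (fun i => G (proj1_sig i)); split=> [countI|i j ij /G_inj E|i|i Gamma fpG compl|i fl].
- have [h hI] := countable_injP _ countI.
  (* Excluded sequences are separated by their codes; the others would be
     separated by natural numbers if I were countable. *)
  pose F (eps : nat -> bool) : nat + presentation_code :=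
    match pselect (exists c, coded_by p c (G eps)) with
    | left e => inr (projT1 (cid e))
    | right ne => inl (h (exist _ eps ne))
    end.
  apply: (@cantor_bool (pickle \o F)); apply: inj_comp; first exact: pcan_inj pickleK.
  move=> eps eps'; rewrite /F.
  case: pselect => [e|ne]; case: pselect => [e'|ne'] //.
    case: (cid e) (cid e') => c ce [c' ce'] /= [cc']; subst c'.
    exact: G_inj (coded_by_commensurable (pG _) (pG _) ce ce').
  case=> /hI E; have := E (mem_set Logic.I) (mem_set Logic.I).
  by move=> /(congr1 (@proj1_sig _ _)).
- case: i j ij E => [e ne] [e' ne'] /= ij E; apply: ij; exact: eq_exist.
- split; [exact: pG | exact: semidirect_finitely_presented |].
  exact: semidirect_min_generators.
- exact: (proj2_sig i) (completion_coded fpG compl).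
- exact: (proj2_sig i) (finite_length_coded (pG _) fl).
Qed.
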